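(* Let $k \geq 3$ be an integer. Then for every $\epsilon > 0$ there is a $c > 0$ such that $$h(k,4) \geq \min\left\{ W(\lfloor c k^2 \rfloor, 2),\ 2^{k^{2.5-\epsilon}} \right\}.$$
   Context: For integers $k, r \geq 2$, the Van der Waerden number $W(k,r)$ is the smallest $n$ such that in every $r$--coloring of $[n]=\{1,\dots,n\}$ some color class contains a $k$--term arithmetic progression $\{x_0 + dj : 0 \le j \le k-1\}$. For a set $A \subseteq \mathbb{Z}$, its restricted sumset is $\Sigma^* A = \{\sum_{b \in B} b : B \subseteq A\}$. An affine $k$--cube (Hilbert cube) is a set of the form $x_0 + \Sigma^* A$ with $x_0 \in \mathbb{Z}$ and $A \subseteq \mathbb{Z}$ a set of exactly $k$ distinct integers. The Hilbert cube number $h(k,r)$ is the smallest $n$ such that in every $r$--coloring of $[n]$ some color class contains an affine $k$--cube. *)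

(* Defs.v *)
From mathcomp Require Import all_boot all_order all_algebra finmap zify.
From mathcomp Require Import boolp classical_sets reals exp.

Set Implicit Arguments.
Unset Strict Implicit.
Unset Printing Implicit Defensive.

Import Order.TTheory GRing.Theory Num.Theory.
Local Open Scope classical_set_scope.
Local Open Scope ring_scope.

Definition arith_prog (k : nat) (x0 d : int) : set int :=
  [set x0 + d * j%:Z | j in `I_k].

Definition contains_AP (k : nat) (S : set int) : Prop :=
  exists x0 d : int, 0 < d /\ arith_prog k x0 d `<=` S.

Definition restricted_sumset (A : {fset int}) : set int :=
  [set \sum_(b <- B) b | B in [set B : {fset int} | (B `<=` A)%fset]].

(* The k distinct integers of A may be zero or negative. *)
Definition is_affine_cube (k : nat) (Q : set int) : Prop :=
  exists (x0 : int) (A : {fset int}),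
    #|` A|%N = k /\ Q = [set x0 + s | s in restricted_sumset A].

Definition contains_cube (k : nat) (S : set int) : Prop :=
  exists2 Q, is_affine_cube k Q & Q `<=` S.

(* An r-coloring of [n] is given by a total function on the integers, of which
   only the values on {1, ..., n} matter. *)
Definition color_class (r n : nat) (f : int -> 'I_r) (i : 'I_r) : set int :=
  [set x | 1 <= x <= n%:Z /\ f x = i].

Definition vdW_property (k r n : nat) : Prop :=
  forall f : int -> 'I_r, exists i, contains_AP k (color_class n f i).

Definition cube_property (k r n : nat) : Prop :=
  forall f : int -> 'I_r, exists i, contains_cube k (color_class n f i).

(* Van der Waerden's theorem, by color focusing; it makes the minima defining
   W(k,r) and h(k,r) well defined. *)

Section VanDerWaerden.
Local Open Scope nat_scope.

(* The point x + d * k is only required to lie in the interval. *)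
Definition vdW_strong (k : nat) (T : finType) := exists N, forall (f : nat -> T) a,
  exists x d, [/\ a <= x, 0 < d, x + d * k < a + N &
    forall j, j < k -> f (x + d * j) = f x].

Definition mono_AP (k : nat) (T : finType) (f : nat -> T) a N := exists x d,
  [/\ a <= x, 0 < d, x + d * k < a + N &
    forall j, j <= k -> f (x + d * j) = f x].

Definition focused (k : nat) (T : finType) (f : nat -> T) a N s :=
  exists z (D : seq (nat * nat)),
  [/\ a <= z < a + N, size D = s, uniq [seq f p.1 | p <- D] &
    forall p, p \in D -> [/\ a <= p.1, 0 < p.2, p.1 + p.2 * k = z &
      forall j, j < k -> f (p.1 + p.2 * j) = f p.1]].

Lemma mono_AP_sub k (T : finType) (f : nat -> T) a N a' N' :
  a <= a' -> a' + N' <= a + N -> mono_AP k f a' N' -> mono_AP k f a N.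
Proof.
move=> h1 h2 [x [d [? ? ? ?]]]; exists x, d; split=> //; lia.
Qed.

Lemma focusing k (T : finType) : (forall U : finType, vdW_strong k U) ->
  forall s, exists N, forall (f : nat -> T) a,
    mono_AP k f a N \/ focused k f a N s.
Proof.
move=> IHk; elim=> [|s [N IHs]].
  exists 1 => f a; right; exists a, [::]; split=> //; lia.
have [M HM] := IHk {ffun 'I_N -> T}.
exists (M * N) => f a.
have [m [e [_ e0 me He]]] := HM (fun m => [ffun i : 'I_N => f (a + m * N + i)]) 0.
have shift y j : a + m * N <= y < a + m * N + N -> j < k ->
    f (y + e * N * j) = f y.
  move=> /andP[y1 y2] jk.
  have iN : y - (a + m * N) < N by lia.
  have /ffunP/(_ (Ordinal iN)) := He j jk; rewrite !ffunE /= => E.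
  have -> : y = a + m * N + (y - (a + m * N)) by lia.
  rewrite -E; congr f; lia.
have mM : (m + e * k).+1 * N <= M * N by rewrite leq_mul2r; apply/orP; right; lia.
have sub : a + m * N + N <= a + M * N by nia.
case: (IHs f (a + m * N)) => [mono|[z [D [zb sD uD HD]]]].
  by left; apply: mono_AP_sub mono; lia.
have N0 : 0 < N by lia.
have [/mapP[q qD fz]|new] := boolP (f z \in [seq f p.1 | p <- D]).
  have [q1 q2 q3 q4] := HD q qD; left.
  apply: (@mono_AP_sub _ _ _ _ _ (a + m * N) N); [lia|lia|].
  exists q.1, q.2; split=> // [|j]; first by rewrite q3; case/andP: zb.
  by rewrite leq_eqVlt => /orP[/eqP ->|]; [rewrite q3|exact: q4].
right; exists (z + e * N * k), ((z, e * N) :: [seq (p.1, p.2 + e * N) | p <- D]).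
split=> /=; [|by rewrite size_map sD|by rewrite -map_comp /= new|].
  move: mM zb; rewrite mulSn mulnDl -!mulnA [(k * N)%N]mulnC.
  set u := (m * N)%N; set v := (e * _)%N; set w := (M * N)%N.
  by clearbody u v w; clear; move=> ? /andP[? ?]; apply/andP; split; lia.
move=> p; rewrite inE => /orP[/eqP -> /=|/mapP[q qD -> /=]].
  by split=> [||//|j jk]; [lia|rewrite muln_gt0 e0|exact: shift].
have [q1 q2 q3 q4] := HD q qD.
split=> [|||j jk]; [exact: leq_trans (leq_addr _ _) q1|by rewrite addn_gt0 q2|
  by rewrite mulnDl addnA q3|].
rewrite -(q4 j jk) -[RHS](shift _ j) //; first by rewrite mulnDl addnA.
have : q.2 * j <= q.2 * k by rewrite leq_mul2l (ltnW jk) orbT.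
rewrite -(leq_add2l q.1) q3 => le; case/andP: zb => _ zN.
by rewrite (leq_trans q1 (leq_addr _ _)) (leq_ltn_trans le zN).
Qed.

Lemma vdW_strong_all k (T : finType) : vdW_strong k T.
Proof.
elim: k T => [T|k IHk T].
  by exists 1 => f a; exists a, 1; split=> //; lia.
have [->|k0] := posnP k.
  exists 2 => f a; exists a, 1; split=> // [|j]; first by lia.
  by rewrite ltnS leqn0 => /eqP ->; rewrite muln0 addn0.
have [N HN] := focusing T IHk #|T|.+1.
exists (2 * N) => f a.
case: (HN f a) => [[x [d [ax d0 xN fx]]]|[z [D [_ sD uD _]]]].
  exists x, d; split=> //.
  have : d * 1 <= d * k by rewrite leq_mul2l k0 orbT.
  by rewrite mulnS; lia.
have /card_uniqP eqc := uD.
by have := max_card (mem [seq f p.1 | p <- D]); rewrite eqc size_map sD ltnn.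
Qed.

End VanDerWaerden.

Lemma vdW_exists (k r : nat) : exists n, `[< vdW_property k r n >].
Proof.
have [N HN] := vdW_strong_all k 'I_r.
exists N; apply/asboolP => f.
have [x [d [x1 d0 xN fx]]] := HN (fun m : nat => f m%:Z) 1%N.
exists (f x%:Z), x%:Z, d%:Z; split; first by lia.
move=> _ [j /= jk <-]; rewrite -PoszM -PoszD; split; last exact: fx.
have : (d * j <= d * k)%N by rewrite leq_mul2l (ltnW jk) orbT.
by lia.
Qed.

Lemma cube_exists (k r : nat) : exists n, `[< cube_property k r n >].
Proof.
have [n /asboolP Hn] := vdW_exists (k * k).+1 r.
exists n; apply/asboolP => f; have [i [x0 [d [d0 Hd]]]] := Hn f.
pose g (j : nat) : int := d * j%:Z.
have ginj : injective g.
  by move=> a b /(mulfI (lt0r_neq0 d0)) [].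
pose A := [fset x in map g (iota 0 k)]%fset.
have cA : #|` A|%N = k.
  by rewrite card_fseq undup_id ?size_map ?size_iota // map_inj_uniq ?iota_uniq.
exists i; exists [set x0 + s | s in restricted_sumset A]; first by exists x0, A.
move=> _ [_ [B /= BA <-] <-]; apply: Hd.
have sB : (size B <= k)%N by rewrite -cA; exact: fsubset_leq_card.
have inB b : b \in (B : seq int) -> exists2 m, (m <= k)%N & b = g m.
  move=> /(fsubsetP BA); rewrite inE => /mapP[m].
  by rewrite mem_iota => /andP[_ mk] ->; exists m; first by lia.
have [m mk ->] : exists2 m, (m <= size B * k)%N & \sum_(b <- B) b = g m.
  elim: {BA sB} (B : seq int) inB => [|b s IH] inB.
    by exists 0%N; rewrite ?big_nil /g ?mulr0.
  have [m mk Em] := IH (fun c cs => inB c (mem_behead (s := b :: s) cs)).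
  have [m' mk' Em'] := inB b (mem_head _ _).
  exists (m' + m)%N; first exact: leq_add mk' mk.
  by rewrite big_cons Em Em' /g PoszD mulrDr.
by exists m => //=; rewrite ltnS (leq_trans mk) // leq_mul2r sB orbT.
Qed.

Definition vdW (k r : nat) : nat := ex_minn (vdW_exists k r).

Definition hilbert (k r : nat) : nat := ex_minn (cube_exists k r).

(* Main.v *)
(* Take the product of a 2-coloring without long progressions and of a random
   2-coloring. The first excludes the monochromatic cubes that contain a
   progression of length c k^2, the second those with more than about
   k^(5/2) / log k elements, so it suffices that every cube of dimension k has one
   of these two properties. Write S for the set of subset sums of A, #|A| = k.

   Union bound. A maximal dissociated subset B of A has size at most log2 #|S| and
   A lies in the difference set of the subset sums of B; hence A is determined by
   O(log k) elements and O(k log k) bits.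

   Few subset sums force a long progression. Build S greedily, each time adding the
   element a of A for which (a + S) \ S is largest. As a |-> #|(a + S) \ S| is
   subadditive, a set r of half of the elements remains such that the m-fold sumset
   of r has fewer than 2 #|S| elements for all m up to k / (C log k). Translate r so
   that its least element is 0 and let N be its largest one. Then
   #|(m+1) r| >= #|m r| + #|m r mod N|, and modulo N each doubling of m multiplies
   the size by at least 3/2 until a subgroup is filled. As 2 * 3/2 = 3 > 2^(3/2),
   the subgroup is reached, and r lies in a progression of length less than
   c' k^(3/2).

   A subset B of [0, N] with N at most c' b^(3/2), b = #|B|, has b/C disjoint pairs
   with differences O(N/b), so some difference d is repeated often and yields a
   progression of difference d longer than N/b. Disjoint pairs with difference j d,
   where j is at most the current length, extend it by j; this first reaches length
   2N. If many pairs are incongruent mod d, a repeated residue of their differences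
   lets one replace d by a proper divisor; otherwise most of B lies in one class
   mod d, and pairs at distance at least c b d extend the length to c b^2. *)
Require Import Defs.
From mathcomp Require Import all_boot all_order all_algebra finmap zify.
From mathcomp Require Import ring lra.
From mathcomp Require Import reals exp.
Set Implicit Arguments.
Unset Strict Implicit.
Unset Printing Implicit Defensive.
Import Order.TTheory GRing.Theory Num.Theory.

(** * Subset sums, iterated sumsets and their greedy growth *)

Section SubsetSums.
Local Open Scope fset_scope.
Local Open Scope nat_scope.
Implicit Types (s u r : seq int) (S T X : {fset int}).

Definition translate (a : int) S : {fset int} := [fset (a + x)%R | x in S].

Lemma mem_translate a S x : (x \in translate a S) = ((x - a)%R \in S).
Proof.
apply/imfsetP/idP => [[y /= yS ->]|xS]; first by rewrite addrC addKr.
by exists (x - a)%R => //; rewrite addrC subrK.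
Qed.

Lemma card_translate a S : #|` translate a S| = #|` S|.
Proof. by rewrite card_imfset //; exact: addrI. Qed.

Fixpoint subset_sums s : {fset int} :=
  if s is a :: s' then subset_sums s' `|` translate a (subset_sums s')
  else [fset 0%R].

Lemma subset_sumsP s x :
  reflect (exists2 t, subseq t s & x = (\sum_(b <- t) b)%R) (x \in subset_sums s).
Proof.
apply: (iffP idP) => [|[t ts ->]].
  elim: s x => [|a s IH] x /=.
    by rewrite inE => /eqP ->; exists [::]; rewrite ?big_nil.
  rewrite inE mem_translate => /orP[/IH[t ts ->]|/IH[t ts xE]].
    by exists t => //; exact: subseq_trans ts (subseq_cons _ _).
  exists (a :: t); first by rewrite /= eqxx.
  by rewrite big_cons -xE addrC subrK.
elim: s t ts => [|a s IH] t; first by rewrite subseq0 => /eqP ->; rewrite big_nil inE.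
rewrite /=.
case: t => [_|b t]; first by rewrite inE IH // sub0seq.
rewrite inE mem_translate; case: eqP => [-> ts|_ ts]; last by rewrite IH.
by rewrite big_cons [(a + _)%R]addrC addrK IH ?orbT.
Qed.

(** Multiplicities instead of subsequences: this form does not see the order of the list, so
    monotonicity and permutation invariance follow at once. *)
Lemma subset_sums_count s x :
  reflect (exists2 t, forall y, count_mem y t <= count_mem y s & x = (\sum_(b <- t) b)%R)
    (x \in subset_sums s).
Proof.
apply: (iffP (subset_sumsP s x)) => [[t ts ->]|[t /count_subseqP[t' t's tt'] ->]].
  by exists t => // y; exact: leq_count_subseq.
by exists t' => //; exact: perm_big.
Qed.

Lemma sub_subset_sums s t : (forall y, count_mem y s <= count_mem y t) ->
  subset_sums s `<=` subset_sums t.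
Proof.
move=> st; apply/fsubsetP => x /subset_sums_count[v vs ->]; apply/subset_sums_count.
by exists v => // y; exact: leq_trans (vs y) (st y).
Qed.

Lemma perm_subset_sums s t : perm_eq s t -> subset_sums s = subset_sums t.
Proof.
move=> /permP st; apply/eqP; rewrite eqEfsubset.
by rewrite !sub_subset_sums // => y; rewrite st.
Qed.

Lemma subset_sums0 s : 0%R \in subset_sums s.
Proof. by apply/subset_sumsP; exists [::]; rewrite ?sub0seq ?big_nil. Qed.

Lemma card_subset_sums_gt0 s : 0 < #|` subset_sums s|.
Proof. by rewrite cardfs_gt0; apply/fset0Pn; exists 0%R; exact: subset_sums0. Qed.

Definition growth S (a : int) := #|` translate a S `\` S|.

Lemma card_fsetU_translate S a : #|` S `|` translate a S| = #|` S| + growth S a.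
Proof.
rewrite /growth cardfsU cardfsD addnBA; last by rewrite fsubset_leq_card // fsubsetIl.
by rewrite fsetIC.
Qed.

Lemma card_subset_sums_cons a s :
  #|` subset_sums (a :: s)| = #|` subset_sums s| + growth (subset_sums s) a.
Proof. exact: card_fsetU_translate. Qed.

Lemma growth_card S a : growth S a + #|` translate a S `&` S| = #|` S|.
Proof. by rewrite /growth cardfsD subnK ?card_translate // -(card_translate a S) fsubset_leq_card // fsubsetIl. Qed.

(** Let [x] lie in [a + b + S] but not in [S]. If [x - a] is in [S], then [x] is counted by
    [growth S a]; otherwise [x - a] is counted by [growth S b]. *)
Lemma growthD S a b : growth S (a + b)%R <= growth S a + growth S b.
Proof.
rewrite /growth -(card_translate a (translate b S `\` S)) addnC.
apply: (leq_trans _ (leq_card_fsetU _ _)).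
apply: fsubset_leq_card; apply/fsubsetP => x.
rewrite !inE !mem_translate !inE !mem_translate => /andP[-> /=].
by rewrite opprD addrA => ->; rewrite andbT orNb.
Qed.

Fixpoint msum m r : {fset int} :=
  if m is m'.+1 then \bigcup_(a <- r) translate a (msum m' r) else [fset 0%R].

Lemma msumSP m r x :
  reflect (exists a y, [/\ a \in r, y \in msum m r & x = (a + y)%R]) (x \in msum m.+1 r).
Proof.
apply: (iffP (bigfcupP _ _ _ _)) => [[a]|[a [y [ar ym ->]]]].
  rewrite andbT mem_translate => ar xm; exists a, (x - a)%R; split=> //.
  by rewrite addrC subrK.
by exists a; rewrite ?ar // mem_translate [(a + y)%R]addrC addrK.
Qed.

Lemma msum_sub m r r' : {subset r <= r'} -> msum m r `<=` msum m r'.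
Proof.
move=> rr; elim: m => [|m IH]; first exact: fsubset_refl.
apply/fsubsetP => x /msumSP[a [y [ar ym ->]]]; apply/msumSP.
by exists a, y; split=> //; [exact: rr|exact: (fsubsetP IH)].
Qed.

Lemma growth_msum S r m l x : (forall a, a \in r -> growth S a <= l) ->
  x \in msum m r -> growth S x <= m * l.
Proof.
move=> rl; elim: m x => [|m IH] x.
  rewrite inE => /eqP ->; rewrite mul0n leqn0 cardfs_eq0 fsetD_eq0.
  by apply/fsubsetP => y; rewrite mem_translate subr0.
move=> /msumSP[a [y [ar ym ->]]].
by rewrite mulSn (leq_trans (growthD _ _ _)) // leq_add ?rl ?IH.
Qed.

(** Double counting: for fixed [y] in [S], the map [x |-> y - x] injects the contributing [x] into
    [S]. *)
Lemma sum_card_translateI S T :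
  \sum_(x <- T) #|` translate x S `&` S| <= #|` S| * #|` S|.
Proof.
have -> : \sum_(x <- T) #|` translate x S `&` S| =
    \sum_(x <- T) \sum_(y <- S) ((y - x)%R \in S).
  apply: eq_bigr => x _; rewrite -big_mkcond /= sum1_count -size_filter.
  have -> : translate x S `&` S = [fset y in [seq y <- S | (y - x)%R \in S]].
    by apply/fsetP => y; rewrite !inE mem_translate mem_filter.
  by rewrite card_fseq undup_id // filter_uniq // fset_uniq.
rewrite exchange_big /= -{2}[#|` S|]sum1_size big_distrr /= big_seq [X in _ <= X]big_seq.
apply: leq_sum => y yS; rewrite muln1 -big_mkcond /= sum1_count -size_filter.
rewrite -(size_map (fun x => y - x)%R); apply: uniq_leq_size.
  by rewrite map_inj_uniq ?filter_uniq ?fset_uniq // => a b /addrI/oppr_inj.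
by move=> z /mapP[x]; rewrite mem_filter => /andP[h _] ->.
Qed.

(** Averaging: otherwise every [x] in [T] keeps more than half of [S] inside [S], and the sum of the
    previous lemma exceeds [#|T| * #|S| / 2 >= #|S|^2]. *)
Lemma ex_large_growth S T : 0 < #|` S| -> 2 * #|` S| <= #|` T| ->
  exists2 x, x \in T & #|` S| <= 2 * growth S x.
Proof.
move=> S0 ST.
have arith g i n : g + i = n -> 2 * g < n -> 1 * n.+1 <= 2 * i by lia.
apply/hasP; apply: contraT => /hasPn H.
have : #|` T| * #|` S|.+1 <= 2 * (#|` S| * #|` S|).
  apply: leq_trans (leq_mul (leqnn 2) (sum_card_translateI S T)).
  rewrite -[#|` T|]sum1_size big_distrl big_distrr /= big_seq [X in _ <= X]big_seq.
  apply: leq_sum => x xT; have := H x xT; rewrite -ltnNge; by apply: arith; exact: growth_card.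
have : 2 * #|` S| * #|` S| <= #|` T| * #|` S| by rewrite leq_mul2r ST orbT.
rewrite mulnS mulnA; lia.
Qed.

Lemma ex_argmax_seq (T : eqType) (f : T -> nat) (r : seq T) : r != [::] ->
  exists2 a, a \in r & forall b, b \in r -> f b <= f a.
Proof.
elim: r => // a [|b r] IH _.
  by exists a; rewrite ?mem_head // => c; rewrite inE => /eqP ->.
have [//|c cr H] := IH _.
have [le|lt] := leqP (f a) (f c).
  exists c; first by rewrite inE cr orbT.
  by move=> x; rewrite inE => /orP[/eqP ->//|]; exact: H.
exists a; first exact: mem_head.
move=> x; rewrite inE => /orP[/eqP ->//|/H xc]; exact: leq_trans xc (ltnW lt).
Qed.

(** If [msum m r] has at least [2 * #|S|] elements, one of them has growth at least [#|S| / 2]; by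
    subadditivity the best single element has growth at least [#|S| / (2m)], so each step multiplies
    [#|S|] by at least [1 + 1/(2m)]. Since [r] shrinks and [S] grows, the condition at the last step
    implies it at all earlier ones. *)
Lemma greedy_growth s t : t <= size s -> exists u r,
  [/\ perm_eq s (u ++ r), size u = t &
    forall m, 2 * #|` subset_sums u| <= #|` msum m r| ->
      (2 * m).+1 ^ t <= #|` subset_sums u| * (2 * m) ^ t].
Proof.
elim: t => [_|t IH ts].
  by exists [::], s; split=> // m _; rewrite !expn0 muln1 card_subset_sums_gt0.
have [u [r [sur su H]]] := IH (ltnW ts).
have r0 : r != [::].
  by apply/eqP => r0; move: ts; rewrite (perm_size sur) r0 cats0 su ltnn.
have [a ar amax] := ex_argmax_seq (growth (subset_sums u)) r0.
exists (a :: u), (rem a r); split=> /=; [|by rewrite su|].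
  apply: (perm_trans sur); rewrite perm_sym -cat1s perm_catCA perm_cat2l perm_sym.
  exact: perm_to_rem.
move=> m le.
have le1 : 2 * #|` subset_sums u| <= #|` msum m (rem a r)|.
  by apply: leq_trans le; rewrite leq_mul2l /= fsubset_leq_card // fsubsetUl.
have rr : {subset rem a r <= r} by exact: mem_rem.
have /H le2 : 2 * #|` subset_sums u| <= #|` msum m r|.
  by apply: leq_trans le1 _; rewrite fsubset_leq_card // msum_sub.
have [x xm xg] := ex_large_growth (card_subset_sums_gt0 u) le1.
have := growth_msum (fun b br => amax b (rr b br)) xm.
rewrite -/(subset_sums (a :: u)) card_subset_sums_cons => xg'.
set S := #|` subset_sums u| in le2 xg *; set g := growth _ a in xg' *.
rewrite !expnS.
apply: (@leq_trans ((2 * m).+1 * (S * (2 * m) ^ t))); first by rewrite leq_mul2l le2 orbT.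
rewrite [(S + g) * _]mulnA [_.+1 * _]mulnA leq_mul2r; apply/orP; right; nia.
Qed.

(** Bernoulli's inequality gives [(1 + 1/n)^n >= 2]; this factor occurs [e] times. *)
Lemma bernoulli_double n t e : 0 < n -> n * e <= t -> 2 ^ e * n ^ t <= n.+1 ^ t.
Proof.
move=> n0 /subnKC <-; rewrite !expnD !expnM mulnA -expnMn leq_mul //; last first.
  by case: (t - n * e) => // i; rewrite leq_exp2r.
have H j : n ^ j * (n + j) <= n.+1 ^ j * n.
  elim: j => [|j IH]; first by rewrite addn0.
  rewrite !expnS; move: IH; set p := n ^ j; set q := n.+1 ^ j => IH; nia.
case: e => // e; rewrite leq_exp2r //.
case: n n0 H => // n _ H; have := H n.+1.
by rewrite addnn -muln2 [_ * (_ * 2)]mulnA [X in X <= _]mulnAC leq_mul2r /= mulnC.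
Qed.

(** Otherwise the greedy steps, each with factor [1 + 1/(2m)], give at least [2 ^ e] subset sums. *)
Lemma small_msum s e : #|` subset_sums s| < 2 ^ e -> exists u r,
  [/\ perm_eq s (u ++ r), size u = (size s)./2 &
    forall m, 2 * m * e <= (size s)./2 -> #|` msum m r| < 2 * #|` subset_sums s|].
Proof.
move=> se.
have [|u [r [sur su H]]] := @greedy_growth s (size s)./2; first by lia.
exists u, r; split=> // m me; rewrite ltnNge; apply/negP => le.
have us : #|` subset_sums u| <= #|` subset_sums s|.
  apply/fsubset_leq_card/sub_subset_sums => y.
  by have /permP -> := sur; rewrite count_cat leq_addr.
have := H m; rewrite (leq_trans _ le) ?leq_mul2l ?us // => /(_ isT).
have [m0|m0] := posnP m.
  have : 2 * #|` subset_sums s| <= 1 by rewrite (leq_trans le) // m0 cardfs1.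
  by have := card_subset_sums_gt0 s; lia.
have m2 : 0 < 2 * m by rewrite muln_gt0.
move=> h2; have := leq_trans (bernoulli_double m2 me) h2.
by rewrite leq_pmul2r ?expn_gt0 ?muln_gt0 ?m0 //; lia.
Qed.

End SubsetSums.

(** * Sets of doubling less than 3/2 in a finite abelian group *)

Section SmallDoubling.
Local Open Scope nat_scope.
Variable G : finZmodType.
Implicit Types X Y : {set G}.

Definition sumset X Y : {set G} := [set (x + y)%R | x in X, y in Y].

Definition stranslate (a : G) X : {set G} := [set (a + x)%R | x in X].

Lemma mem_stranslate a X u : (u \in stranslate a X) = ((u - a)%R \in X).
Proof.
apply/imsetP/idP => [[x xX ->]|uX]; first by rewrite [(a + x)%R]addrC addrK.
by exists (u - a)%R => //; rewrite addrC subrK.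
Qed.

Lemma card_stranslate a X : #|stranslate a X| = #|X|.
Proof. by rewrite card_imset //; exact: addrI. Qed.

(* Every difference of elements of X has more than #|X| / 2 representations, so
   the differences form a subgroup, of which X fills more than one half. *)
Lemma small_doubling_subgroup X : 0%R \in X -> 2 * #|sumset X X| < 3 * #|X| ->
  {in sumset X X &, forall x y, (x - y)%R \in sumset X X}.
Proof.
move=> X0 small.
pose D : {set G} := [set (x - y)%R | x in X, y in X].
pose rep z := X :&: stranslate z X.
have repE z u : (u \in rep z) = (u \in X) && ((u - z)%R \in X).
  by rewrite inE mem_stranslate.
have Xgt0 : 0 < #|X| by apply/card_gt0P; exists 0%R.
have rep_big z : z \in D -> #|X| < 2 * #|rep z|.
  move=> /imset2P[x y xX yX zE].
  (* As [z = x - y], translating [rep z] by [y] gives the intersection of [y + X] and [x + X], two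
     sets inside [X + X], which is too small for them to overlap little. *)
  have <- : #|stranslate y X :&: stranslate x X| = #|rep z|.
    rewrite -(card_stranslate y (rep z)); congr #|pred_of_set _|; apply/setP => u.
    by rewrite !inE !mem_stranslate repE zE opprB addrA subrK.
  have : #|stranslate y X :|: stranslate x X| <= #|sumset X X|.
    apply/subset_leq_card/subsetP => u; rewrite inE !mem_stranslate => /orP[] uX.
      by apply/imset2P; exists y (u - y)%R => //; rewrite addrC subrK.
    by apply/imset2P; exists x (u - x)%R => //; rewrite addrC subrK.
  have := cardsUI (stranslate y X) (stranslate x X); rewrite !card_stranslate; lia.
have meet (Y Z W : {set G}) : Y \subset W -> Z \subset W -> #|W| < #|Y| + #|Z| ->
    exists2 u, u \in Y & u \in Z.
  move=> YW ZW lt; have : 0 < #|Y :&: Z|.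
    have : #|Y :|: Z| <= #|W| by rewrite subset_leq_card // subUset YW.
    have := cardsUI Y Z; lia.
  by move=> /card_gt0P[u]; rewrite inE => /andP[uY uZ]; exists u.
(* [rep z] and [rep w] each fill more than half of [X], so they share some [u], and
   [z - w = (u - w) - (u - z)]. *)
have DB : {in D &, forall z w, (z - w)%R \in D}.
  move=> z w /rep_big zD /rep_big wD.
  have [|||u] := meet (rep z) (rep w) X; [exact: subsetIl|exact: subsetIl|lia|].
  rewrite !repE => /andP[uX uz] /andP[_ uw]; apply/imset2P.
  by exists (u - w)%R (u - z)%R => //; rewrite opprB [RHS]addrC addrA subrK.
have D0 : 0%R \in D by apply/imset2P; exists 0%R 0%R; rewrite ?subr0.
have XD : X \subset D.
  by apply/subsetP => x xX; apply/imset2P; exists x 0%R; rewrite ?subr0.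
(* Each of the differences accounts for more than [#|X| / 2] of the [#|X|^2] pairs. *)
have Dsmall : #|D| < 2 * #|X|.
  have H : \sum_(z in D) #|rep z| <= #|X| * #|X|.
    have -> : \sum_(z in D) #|rep z| = \sum_(z in D) \sum_(u in X | (u - z)%R \in X) 1.
      by apply: eq_bigr => z _; rewrite -sum1_card; apply: eq_bigl => u; rewrite repE.
    rewrite (exchange_big_dep (mem X)) /=; last by move=> z u _ /andP[].
    rewrite -sum_nat_const; apply: leq_sum => u uX; rewrite sum1_card.
    apply: leq_trans (leq_imset_card (fun x => u - x)%R (mem X)).
    apply/subset_leq_card/subsetP => z; rewrite unfold_in => /and3P[_ _ uz].
    by apply/imsetP; exists (u - z)%R; rewrite ?subKr.
  have : #|D| * #|X|.+1 <= 2 * \sum_(z in D) #|rep z|.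
    rewrite -sum_nat_const big_distrr /=; apply: leq_sum => z; exact: rep_big.
  nia.
suff -> : sumset X X = D by exact: DB.
apply/eqP; rewrite eqEsubset; apply/andP; split; apply/subsetP => h.
  move=> /imset2P[x y xX yX ->]; rewrite -[y]opprK -[(- y)%R]add0r.
  by rewrite !DB ?(subsetP XD).
move=> hD.
(* [X] and [h - X] lie in [D] and are jointly larger than [D]; a common element writes [h] as a
   sum. *)
have [||u uX] := meet X [set (h - x)%R | x in X] D XD.
- by apply/subsetP => u /imsetP[x xX ->]; rewrite DB // (subsetP XD).
- rewrite card_in_imset; first by rewrite addnn -mul2n.
  by move=> x y _ _ /addrI/oppr_inj.
move=> /imsetP[x xX uE]; apply/imset2P; exists u x => //.
by rewrite uE subrK.
Qed.

End SmallDoubling.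

(** * Growth of iterated sumsets through residues modulo the largest element *)

Section Reduction.
Local Open Scope fset_scope.
Local Open Scope nat_scope.
Implicit Types r : seq int.

Lemma msumDP m m' r x :
  reflect (exists y z, [/\ y \in msum m r, z \in msum m' r & x = (y + z)%R])
    (x \in msum (m + m') r).
Proof.
elim: m x => [|m IH] x.
  rewrite add0n; apply: (iffP idP) => [xm|[y [z [+ zm ->]]]].
    by exists 0%R, x; rewrite add0r /= inE.
  by rewrite inE => /eqP ->; rewrite add0r.
rewrite addSn; apply: (iffP (msumSP _ _ _)).
  move=> [a [_ [ar /IH[y [z [ym zm ->]]] ->]]]; exists (a + y)%R, z.
  by rewrite addrA; split=> //; apply/msumSP; exists a, y.
move=> [_ [z [/msumSP[a [y [ar ym ->]]] zm ->]]]; exists a, (y + z)%R.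
by rewrite addrA; split=> //; apply/IH; exists y, z.
Qed.

Lemma msum1 r x : (x \in msum 1 r) = (x \in r).
Proof.
apply/msumSP/idP => [[a [y [ar]]]|xr]; first by rewrite inE => /eqP -> ->; rewrite addr0.
by exists x, 0%R; rewrite inE addr0.
Qed.

Variable n : nat.
(** The shape [n.+2] gives ['I_N] the ring structure of the integers modulo [N]. *)
Local Notation N := (n.+2).
Variable r : seq int.
Hypothesis r_uniq : uniq r.
Hypothesis r0 : 0%R \in r.
Hypothesis rN : (Posz N) \in r.
Hypothesis r_bound : forall x, x \in r -> (0 <= x <= (Posz N))%R.

Let pr (z : int) : 'I_N := (z%:~R)%R.

Lemma residue_eq0 z : (pr z == 0%R) = ((Posz N) %| z)%Z.
Proof.
have nat_case (k : nat) : (pr k == 0%R) = (N %| k).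
  by rewrite /pr -pmulrn -val_eqE /dvdn -(@val_Zp_nat N isT k).
case: z => k; first by rewrite nat_case.
by rewrite NegzE dvdzE abszN /= /pr mulrNz oppr_eq0 -/(pr _) nat_case.
Qed.

Lemma residueD x y : pr (x + y)%R = (pr x + pr y)%R.
Proof. by rewrite /pr intrD. Qed.

Lemma residueB x y : pr (x - y)%R = (pr x - pr y)%R.
Proof. by rewrite /pr intrB. Qed.

Lemma residue_inj x y : (0 <= x < (Posz N))%R -> (0 <= y < (Posz N))%R -> pr x = pr y -> x = y.
Proof.
move=> xb yb /eqP; rewrite -subr_eq0 -residueB residue_eq0 => /dvdzP[q qE].
have : q = 0%R by nia.
lia.
Qed.

Definition residues m : {set 'I_N} := [set z in [seq pr x | x <- msum m r]].

Lemma residuesP m c :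
  reflect (exists2 x, x \in msum m r & c = pr x) (c \in residues m).
Proof. by rewrite inE; exact: mapP. Qed.

Lemma residuesD m m' : residues (m + m') = sumset (residues m) (residues m').
Proof.
apply/setP => z; apply/residuesP/imset2P.
  move=> [_ /msumDP[x [y [xm ym ->]]] ->]; exists (pr x) (pr y); rewrite ?residueD //.
    by apply/residuesP; exists x.
  by apply/residuesP; exists y.
move=> [_ _ /residuesP[x xm ->] /residuesP[y ym ->] ->]; exists (x + y)%R.
  by apply/msumDP; exists x, y.
by rewrite residueD.
Qed.

Lemma msum0 m : 0%R \in msum m r.
Proof.
elim: m => [|m IH]; first by rewrite inE.
by apply/msumSP; exists 0%R, 0%R; rewrite addr0.
Qed.

Lemma residues0 m : 0%R \in residues m.
Proof. by apply/residuesP; exists 0%R; rewrite ?msum0 // /pr mulr0z. Qed.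

Lemma residues_sub m m' : residues m \subset residues (m + m').
Proof.
apply/subsetP => z zm; rewrite residuesD; apply/imset2P.
by exists z 0%R; rewrite ?residues0 ?addr0.
Qed.

Lemma msum_bound m x : x \in msum m r -> (0 <= x <= (Posz (m * N)))%R.
Proof.
elim: m x => [|m IH] x; first by rewrite inE => /eqP ->.
move=> /msumSP[a [y [/r_bound ab /IH yb ->]]]; rewrite mulSn PoszD; lia.
Qed.

(** Both [X] and [N + X] lie in the next sumset, as [0] and [N] are in [r]. Starting from any [x] in
    the bounded set [X], the first of [x + N], [x + 2N], ... outside [X] lies in [N + X], so [N + X]
    minus [X] meets every residue class of [X]. *)
Lemma card_msumS m : #|` msum m r| + #|residues m| <= #|` msum m.+1 r|.
Proof.
set X := msum m r.
have sub : X `|` translate (Posz N) X `<=` msum m.+1 r.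
  rewrite fsubUset; apply/andP; split; apply/fsubsetP => x xX; apply/msumSP.
    by exists 0%R, x; rewrite add0r.
  rewrite mem_translate in xX; exists (Posz N), (x - (Posz N))%R; split=> //.
  by rewrite addrC subrK.
apply: leq_trans (fsubset_leq_card sub); rewrite card_fsetU_translate leq_add2l /growth.
set Y := translate _ _ `\` X.
have : residues m \subset [set z in [seq pr x | x <- Y]].
  apply/subsetP => _ /residuesP[x xX ->]; rewrite inE; apply/mapP.
  have ex : exists i, (x + (Posz (i * N)))%R \notin X.
    exists m.+1; apply/negP => /msum_bound; have := msum_bound xX.
    by rewrite mulSn; lia.
  case: (ex_minnP ex) => -[|i] iX imin; first by rewrite mul0n addr0 xX in iX.
  exists (x + (Posz (i.+1 * N)))%R.
    rewrite in_fsetD iX mem_translate mulSn PoszD [((Posz N) + _)%R]addrC addrA addrK.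
    by apply: contraT => /imin; rewrite ltnn.
  rewrite residueD; have /eqP -> : pr (Posz (i.+1 * N)) == 0%R; last by rewrite addr0.
  by rewrite residue_eq0 dvdzE /= dvdn_mull.
move=> /subset_leq_card /leq_trans; apply.
rewrite cardsE (leq_trans (card_size _)) // size_map; exact: leqnn.
Qed.

Lemma card_msumD m i : i * #|residues m| <= #|` msum (m + i) r|.
Proof.
elim: i => [|i IH]; first by rewrite mul0n.
rewrite addnS mulSn addnC (leq_trans _ (card_msumS _)) // leq_add //.
exact/subset_leq_card/residues_sub.
Qed.

(** Only [N] is lost, being congruent to [0]; the other elements lie in [[0, N)]. *)
Lemma card_residues1 : (size r).-1 <= #|residues 1|.
Proof.
have <- : size (rem (Posz N) r) = (size r).-1 by rewrite size_rem.
rewrite -(size_map pr).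
have u : uniq [seq pr x | x <- rem (Posz N) r].
  rewrite map_inj_in_uniq ?rem_uniq // => x y.
  rewrite !mem_rem_uniq // !inE => /andP[xN /r_bound xb] /andP[yN /r_bound yb].
  apply: residue_inj; lia.
rewrite -(card_uniqP u); apply/subset_leq_card/subsetP => z /mapP[x xr ->].
by apply/residuesP; exists x; rewrite // msum1 (mem_rem xr).
Qed.

(** [h] is the least positive integer with residue in [H]. Division with remainder shows that it
    divides all such integers, among them [N], and its [N / h] multiples below [N] have distinct
    residues in [H]. *)
Lemma subgroup_divisor (H : {set 'I_N}) : {in H &, forall x y, (x - y)%R \in H} ->
  0%R \in H -> exists h : nat, [/\ 0 < h, N <= h * #|H| &
    forall x, pr x \in H -> ((Posz h) %| x)%Z].
Proof.
move=> HB H0.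
have ex : exists h, (0 < h) && (pr (Posz h) \in H).
  exists N; rewrite /=; suff /eqP -> : pr N == 0%R by [].
  by rewrite residue_eq0 dvdzz.
case: (ex_minnP ex) => h /andP[h0 hH] hmin.
have HN z : z \in H -> (- z)%R \in H by move=> zH; rewrite -[(- z)%R]add0r HB.
have HD : {in H &, forall x y, (x + y)%R \in H}.
  by move=> x y xH yH; rewrite -[y]opprK HB // HN.
have Hmul (i : nat) : pr ((Posz h) * (Posz i))%R \in H.
  elim: i => [|i IH]; first by rewrite mulr0 /pr mulr0z.
  by rewrite intS mulrDr mulr1 residueD HD.
have Hmulz (q : int) : pr (q * (Posz h))%R \in H.
  case: q => i; first by rewrite mulrC Hmul.
  by rewrite NegzE mulNr /pr mulrNz HN // -/(pr _) mulrC Hmul.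
have dvd x : pr x \in H -> ((Posz h) %| x)%Z.
  move=> xH; have mH : pr (x %% (Posz h))%Z \in H by rewrite /modz residueB HB.
  have h1 : (0 <= (x %% (Posz h))%Z)%R by rewrite modz_ge0; lia.
  have h2 : ((x %% (Posz h))%Z < (Posz h))%R by rewrite ltz_pmod; lia.
  apply/dvdz_mod0P; move: mH h1 h2; case: (x %% (Posz h))%Z => // i iH _ ih.
  have [->//|i0] := posnP i.
  by have := hmin i; rewrite i0 iH => /(_ isT); lia.
exists h; split=> //.
have /dvdzP[q qE] : ((Posz h) %| (Posz N))%Z.
  by apply: dvd; suff /eqP -> : pr N == 0%R by []; rewrite residue_eq0 dvdzz.
case: q qE => [q|q] qE; last by nia.
have qN : N = q * h by lia.
apply: (@leq_trans (h * q)); first by rewrite mulnC -qN.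
rewrite leq_mul2l; apply/orP; right.
have u : uniq [seq pr ((Posz h) * (Posz i))%R | i <- iota 0 q].
  rewrite map_inj_in_uniq ?iota_uniq // => i j; rewrite !mem_iota !add0n => /andP[_ iq] /andP[_ jq].
  have b k : k < q -> (0 <= (Posz h) * (Posz k) < (Posz N))%R.
    by move=> kq; have : k * h < q * h by [rewrite ltn_mul2r h0]; lia.
  move=> /(residue_inj (b i iq) (b j jq)); nia.
rewrite -{1}(size_iota 0 q) -(size_map (fun i : nat => pr ((Posz h) * (Posz i))%R)) -(card_uniqP u).
by apply/subset_leq_card/subsetP => z /mapP[i _ ->].
Qed.

(** Each doubling either multiplies the number of residues by at least 3/2 or makes them a subgroup.
    In the latter case [r] consists of multiples of [h], and this alternative persists. *)
Lemma residues_growth J : 3 ^ J * (size r).-1 <= 2 ^ J * #|residues (2 ^ J)| \/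
  exists h : nat, [/\ 0 < h, N <= h * #|residues (2 ^ J)| &
    forall x, x \in r -> ((Posz h) %| x)%Z].
Proof.
elim: J => [|J [IH|[h [h0 hN hr]]]]; first by left; rewrite !mul1n card_residues1.
  have E : 2 ^ J.+1 = 2 ^ J + 2 ^ J by rewrite expnS; lia.
  have [le|lt] := leqP (3 * #|residues (2 ^ J)|) (2 * #|residues (2 ^ J.+1)|).
    left; apply: (@leq_trans (2 ^ J * (2 * #|residues (2 ^ J.+1)|))).
      apply: leq_trans (leq_mul (leqnn (2 ^ J)) le).
      by rewrite expnS -mulnA [_ * (3 * _)]mulnCA leq_mul2l IH orbT.
    by rewrite {2}expnS mulnA [2 ^ J * 2]mulnC.
  rewrite E residuesD in lt.
  have [|h [h0 hN hr]] := subgroup_divisor (small_doubling_subgroup (residues0 _) lt).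
    by rewrite -residuesD residues0.
  right; exists h; split=> // [|x xr]; first by rewrite E residuesD.
  apply: hr; rewrite -residuesD; apply/residuesP; exists x => //.
  have -> : 2 ^ J + 2 ^ J = 1 + (2 ^ J.+1).-1 by rewrite E; have := expn_gt0 2 J; lia.
  by apply/msumDP; exists x, 0%R; rewrite msum1 msum0 addr0.
right; exists h; split=> //; apply: leq_trans hN _; rewrite leq_mul2l; apply/orP; right.
by apply/subset_leq_card; rewrite expnS mul2n -addnn residues_sub.
Qed.

(** The second batch of [2 ^ J] summands adds at least [#|residues (2 ^ J)|] elements each time,
    which turns the factor 3/2 per doubling into 3. *)
Lemma msum_growth J : 3 ^ J * (size r).-1 <= #|` msum (2 ^ J + 2 ^ J) r| \/
  exists h : nat, [/\ 0 < h, 2 ^ J * N <= h * #|` msum (2 ^ J + 2 ^ J) r| &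
    forall x, x \in r -> ((Posz h) %| x)%Z].
Proof.
have le := card_msumD (2 ^ J) (2 ^ J).
case: (residues_growth J) => [H|[h [h0 hN hr]]]; first by left; exact: leq_trans le.
right; exists h; split=> //.
apply: leq_trans (leq_mul (leqnn _) hN) _.
by rewrite mulnCA leq_mul2l le orbT.
Qed.

End Reduction.

Definition fcard (K : choiceType) (A : {fset K}) : nat := #|` A|%fset.

(* The carrier of the list underlying a finite set may be displayed in several
   convertible ways, which lia would treat as distinct atoms. *)
Ltac card_lia := repeat match goal with
  | H : context [@size ?T (@enum_fset ?K ?A)] |- _ =>
      change (@size T (@enum_fset K A)) with (@fcard K A) in H
  | |- context [@size ?T (@enum_fset ?K ?A)] =>
      change (@size T (@enum_fset K A)) with (@fcard K A)
  end; lia.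

(** * Long progressions among the subset sums of a dense set of naturals *)

Section LongProgressions.
Local Open Scope fset_scope.
Local Open Scope nat_scope.
Implicit Types (B U V W : {fset nat}) (P : seq (nat * nat)).

Lemma pigeonhole_seq (T : eqType) (s : seq T) (f : T -> nat) n m :
  (forall x, x \in s -> f x < n) -> n * m < size s ->
  exists c, m < size [seq x <- s | f x == c].
Proof.
move=> fn lt.
have E : \sum_(c < n) count (fun x => f x == c) s = size s.
  elim: s fn {lt} => [|a s IH] fn /=; first by rewrite big1.
  rewrite big_split /= IH; last by move=> x xs; rewrite fn // inE xs orbT.
  have an : f a < n by rewrite fn ?mem_head.
  rewrite (bigD1 (Ordinal an)) //= eqxx big1 ?addn0 // => i; rewrite -val_eqE /=.
  by rewrite eq_sym => /negbTE ->.
have [c cm|H] := pickP (fun c : 'I_n => m < count (fun x => f x == c) s).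
  by exists (nat_of_ord c); rewrite size_filter.
suff : size s <= n * m by rewrite leqNgt lt.
rewrite -E -[n in n * m]card_ord -sum_nat_const leq_sum // => c _.
by rewrite leqNgt H.
Qed.

Lemma spread_seq (s : seq nat) m : uniq s -> m < size s ->
  exists a b, [/\ a \in s, b \in s & a + m <= b].
Proof.
move=> us ms; have ex : exists a, a \in s by case: s us ms => // a s _ _; exists a; rewrite mem_head.
case: (ex_minnP ex) => a as_ amin.
have /hasP[b bs ab] : has (fun b => a + m <= b) s; last by exists a, b.
apply: contraLR ms => /hasPn H; rewrite -leqNgt -(size_iota a m).
by apply: uniq_leq_size => // b bs; rewrite mem_iota amin //= ltnNge H.
Qed.

(** A cell is a residue class mod [d] within a block of length [d * L]. Among more than [m] elements
    of one cell, two have quotients by [d] at least [m] apart, and the block keeps them less than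
    [L] apart. *)
Lemma cell_pair V N d L m : (forall x, x \in V -> x <= N) -> 0 < d -> 0 < L ->
  m * (d * (N %/ (d * L)).+1) < #|` V| ->
  exists x y j, [/\ x \in V, y \in V, y = x + d * j & m <= j < L].
Proof.
move=> VN d0 L0 lt; pose key x := x %% d + d * (x %/ (d * L)).
have keyb x : x \in enum_fset V -> key x < d * (N %/ (d * L)).+1.
  move=> /VN xN; rewrite mulnS /key.
  by rewrite -addSn leq_add ?ltn_pmod // leq_mul2l leq_div2r ?orbT.
have [|c cm] := pigeonhole_seq (m := m) keyb; first by rewrite mulnC.
set s := [seq _ <- _ | _] in cm.
have sE x : x \in s -> [/\ x \in V, x %% d = c %% d & x %/ d %/ L = c %/ d].
  rewrite mem_filter => /andP[/eqP kx xV]; split=> //.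
    by rewrite -kx /key addnC mulnC modnMDl modn_mod.
  rewrite -divnMA -kx /key addnC [d * (_ %/ _)]mulnC divnMDl // [_ %% _ %/ _]divn_small ?addn0 //.
  by rewrite ltn_pmod.
have inj : {in s &, injective (fun x => x %/ d)}.
  move=> x y /sE[_ xc _] /sE[_ yc _] q.
  by rewrite (divn_eq x d) (divn_eq y d) q xc yc.
have us : uniq s by rewrite filter_uniq // fset_uniq.
have [||a [b [/mapP[x xs ->] /mapP[y ys ->] le]]] := @spread_seq [seq x %/ d | x <- s] m.
- by rewrite map_inj_in_uniq.
- by rewrite size_map.
have [xV xc xq] := sE x xs; have [yV yc yq] := sE y ys.
exists x, y, (y %/ d - x %/ d); split=> //.
  rewrite {1}(divn_eq y d) {1}(divn_eq x d) xc yc mulnBr ![d * _]mulnC.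
  by rewrite -addnA [_ %% _ + _]addnC addnA subnKC // leq_mul2r; apply/orP; right; lia.
have arith X Y t i j : X = t + i -> Y = t + j -> j < L -> X + m <= Y -> m <= Y - X < L.
  by clear; lia.
have := divn_eq (y %/ d) L; have := divn_eq (x %/ d) L; rewrite xq yq => hx hy.
exact: arith hx hy (ltn_pmod _ L0) le.
Qed.

(* Sums of subsets of a common cardinality p: this makes the notion invariant
   under affine maps. *)
Definition fixed_sum U p z :=
  exists T : {fset nat}, [/\ T `<=` U, #|` T| = p & \sum_(i <- T) i = z].

Definition hasAP U d L := exists p x0, forall j, j < L -> fixed_sum U p (x0 + d * j).

Lemma fixed_sum_sub U V p z : U `<=` V -> fixed_sum U p z -> fixed_sum V p z.
Proof. by move=> UV [T [TU Tp Tz]]; exists T; split=> //; exact: fsubset_trans UV. Qed.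

Lemma hasAP_sub U V d L : U `<=` V -> hasAP U d L -> hasAP V d L.
Proof.
move=> UV [p [x0 H]]; exists p, x0 => j jL; exact: fixed_sum_sub UV (H j jL).
Qed.

Lemma hasAP_le U d L L' : L' <= L -> hasAP U d L -> hasAP U d L'.
Proof.
move=> le [p [x0 H]]; exists p, x0 => j jL; apply: H; exact: leq_trans jL le.
Qed.

Lemma fixed_sumU1 U p z a : a \notin U -> fixed_sum U p z ->
  fixed_sum (a |` U) p.+1 (a + z).
Proof.
move=> aU [T [TU Tp Tz]]; have aT : a \notin T by apply: contra aU; exact: (fsubsetP TU).
exists (a |` T); split; first exact: fsetUS.
  by rewrite cardfsU1 aT Tp.
by rewrite big_fsetU1 // Tz.
Qed.

Definition addpair x y U := x |` (y |` U).

Lemma card_addpair x y U : #|` addpair x y U| <= #|` U| + 2.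
Proof. by rewrite !cardfsU1; case: (_ \notin _); case: (_ \notin _) => /=; card_lia. Qed.

Lemma addpairE x y U z : (z \in addpair x y U) = [|| z == x, z == y | z \in U].
Proof. by rewrite !inE. Qed.

Lemma fixed_sum_left x y U p z : x \notin U -> fixed_sum U p z ->
  fixed_sum (addpair x y U) p.+1 (x + z).
Proof.
move=> xU /(fixed_sumU1 xU); apply: fixed_sum_sub; apply: fsetUS; exact: fsubsetUr.
Qed.

Lemma fixed_sum_right x y U p z : y \notin U -> fixed_sum U p z ->
  fixed_sum (addpair x y U) p.+1 (y + z).
Proof. move=> yU /(fixed_sumU1 yU); apply: fixed_sum_sub; exact: fsubsetUr. Qed.

Lemma hasAP_addpair x y j U d L : x \notin U -> y \notin U -> y = x + d * j -> j <= L ->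
  hasAP U d L -> hasAP (addpair x y U) d (L + j).
Proof.
move=> xU yU yE jL [p [x0 H]]; exists p.+1, (x + x0) => i iL.
have [lt|le] := ltnP i L.
  by rewrite -addnA; apply: fixed_sum_left => //; exact: H.
have -> : x + x0 + d * i = y + (x0 + d * (i - j)).
  by rewrite yE mulnBr; have : d * j <= d * i by [rewrite leq_mul2l; lia]; lia.
apply: fixed_sum_right => //; apply: H; lia.
Qed.

Lemma hasAP_rounds V v m t U d L :
  (forall W, W `<=` V -> v <= #|` W| ->
     exists x y j, [/\ x \in W, y \in W, y = x + d * j & m <= j <= L]) ->
  (forall x, x \in V -> x \notin U) -> v + 2 * t <= #|` V| -> hasAP U d L ->
  exists U', [/\ U' `<=` U `|` V, #|` U'| <= #|` U| + 2 * t & hasAP U' d (L + t * m)].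
Proof.
move=> pair VU tV ap.
suff [U' [h1 h2 [L' le h3]]] : exists U',
    [/\ U' `<=` U `|` V, #|` U'| <= #|` U| + 2 * t &
      exists2 L', L + t * m <= L' & hasAP U' d L'].
  by exists U'; split=> //; exact: hasAP_le h3.
(* The current length [L0] is separated from the bound [L] on the pairs, so that [pair] stays fixed
   while the progression grows. *)
have [L0 le0 {}ap] : exists2 L', L <= L' & hasAP U d L' by exists L.
suff: exists U', [/\ U' `<=` U `|` V, #|` U'| <= #|` U| + 2 * t &
      exists2 L', L0 + t * m <= L' & hasAP U' d L'].
  move=> [U' [h1 h2 [L' h3 h4]]]; exists U'; split=> //; exists L' => //.
  by apply: leq_trans h3; rewrite leq_add2r.
elim: t V U L0 le0 pair VU tV ap => [|t IH] V U L0 le0 pair VU tV ap.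
  by exists U; rewrite muln0 addn0 mul0n addn0; split=> //; [exact: fsubsetUl|exists L0].
have [||x [y [j [xV yV yE /andP[mj jL]]]]] := pair V; [exact: fsubset_refl|lia|].
have [||||U' [h1 h2 [L' h3 h4]]] :=
  IH (V `\ x `\ y) (addpair x y U) (L0 + j) (leq_trans le0 (leq_addr _ _)).
- move=> W WV; apply: pair; apply: fsubset_trans WV _.
  by apply: fsubset_trans (fsubD1set _ _) (fsubD1set _ _).
- by move=> z; rewrite addpairE !inE => /and3P[/negbTE -> /negbTE -> /VU].
- have := cardfsD1 x V; have := cardfsD1 y (V `\ x); rewrite xV.
  by case: (y \in _) => /=; card_lia.
- by apply: hasAP_addpair => //; rewrite ?VU //; exact: leq_trans jL le0.
exists U'; split.
- apply: fsubset_trans h1 _; apply/fsubsetP => z; rewrite inE addpairE !inE.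
  by case/orP => [/or3P[/eqP ->|/eqP ->|->]|/and3P[_ _ ->]]; rewrite ?xV ?yV ?orbT.
- have := card_addpair x y U; card_lia.
- by exists L' => //; apply: leq_trans h3; rewrite mulSn; lia.
Qed.

Definition elements P := flatten [seq [:: p.1; p.2] | p <- P].

Lemma collect_pairs (Phi : nat -> nat -> bool) V v t :
  (forall W, W `<=` V -> v <= #|` W| ->
     exists x y, [/\ x \in W, y \in W, x != y & Phi x y]) ->
  v + 2 * t <= #|` V| ->
  exists P, [/\ size P = t, uniq (elements P), {subset elements P <= V} &
    forall p, p \in P -> Phi p.1 p.2].
Proof.
elim: t V => [|t IH] V pair tV; first by exists [::].
have [||x [y [xV yV xy xyP]]] := pair V; [exact: fsubset_refl|lia|].
have [||P [sP uP PV PhiP]] := IH (V `\ x `\ y).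
- move=> W WV; apply: pair; apply: fsubset_trans WV _.
  by apply: fsubset_trans (fsubD1set _ _) (fsubD1set _ _).
- have := cardfsD1 x V; have := cardfsD1 y (V `\ x); rewrite xV.
  by case: (y \in _) => /=; card_lia.
exists ((x, y) :: P); split=> /=; rewrite ?sP //.
- rewrite uP andbT inE (negbTE xy) /=; apply/andP; split; apply/negP => /PV; rewrite !inE eqxx ?andbF //.
- move=> z; rewrite !inE => /or3P[/eqP ->//|/eqP ->//|/PV].
  by rewrite !inE => /and3P[].
- by move=> p; rewrite inE => /orP[/eqP ->//|]; exact: PhiP.
Qed.

Lemma elements_cons p P : elements (p :: P) = p.1 :: p.2 :: elements P.
Proof. by []. Qed.

Lemma subseq_elements P P' : subseq P P' -> subseq (elements P) (elements P').
Proof.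
elim: P' P => [|p' P' IH] P; first by rewrite subseq0 => /eqP ->.
case: P => [|p P]; first by rewrite sub0seq.
rewrite -[subseq (p :: P) _]/(subseq (if p == p' then P else p :: P) P').
case: eqP => [-> /IH H|_ /IH H]; first by rewrite !elements_cons /= !eqxx.
apply: subseq_trans H _; rewrite elements_cons.
exact: subseq_trans (subseq_cons _ _) (subseq_cons _ _).
Qed.

Lemma hasAP_pairs P B U d L : U `<=` B -> {subset elements P <= B} -> uniq (elements P) ->
  (forall z, z \in elements P -> z \notin U) -> (forall p, p \in P -> p.2 = p.1 + d) ->
  0 < L -> hasAP U d L ->
  exists U', [/\ U' `<=` B, #|` U'| <= #|` U| + 2 * size P & hasAP U' d (L + size P)].
Proof.
elim: P U L => [|[x y] P IH] U L UB PB uP PU Pd L0 ap.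
  by exists U; rewrite muln0 !addn0.
move: uP PB PU; rewrite elements_cons /= inE negb_or => /and3P[/andP[xy xP] yP uP] PB PU.
have xB : x \in B by rewrite PB // inE eqxx.
have yB : y \in B by rewrite PB // !inE eqxx orbT.
have xU : x \notin U by rewrite PU // inE eqxx.
have yU : y \notin U by rewrite PU // !inE eqxx orbT.
have yE : y = x + d * 1 by rewrite muln1; apply: (Pd (x, y)); rewrite mem_head.
have [||||||U' [h1 h2 h3]] := IH (addpair x y U) (L + 1) _ _ uP.
- apply/fsubsetP => z; rewrite addpairE => /or3P[/eqP ->//|/eqP ->//|]; exact: (fsubsetP UB).
- by move=> z zP; rewrite PB // !inE zP !orbT.
- move=> z zP; rewrite addpairE (negbTE (PU z _)) ?inE ?zP ?orbT // orbF negb_or.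
  by apply/andP; split; apply/eqP => E; move: xP yP; rewrite -E zP.
- by move=> p pP; apply: Pd; rewrite inE pP orbT.
- lia.
- by apply: hasAP_addpair.
exists U'; split=> //=; first by have := card_addpair x y U; card_lia.
by have -> : L + (size P).+1 = L + 1 + size P by lia.
Qed.

(* The offsets E realize the multiples of rho mod d: with the progression of
   difference d they give one of difference gcd rho d. *)
Definition hasGrid U d L N rho q := exists p x0, forall i, i <= q ->
  exists E, [/\ E <= i * N, E = i * rho %[mod d] &
    forall j, j < L -> fixed_sum U p (x0 + E + d * j)].

(** With a new pair, the offsets up to [q] are kept by using [x], and offset [q.+1] arises from
    offset [q] by using [y]. *)
Lemma hasGrid_pairs P B U d L N rho q :
  U `<=` B -> {subset elements P <= B} -> uniq (elements P) ->
  (forall z, z \in elements P -> z \notin U) ->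
  (forall p, p \in P -> exists D, [/\ p.2 = p.1 + D, D <= N & D = rho %[mod d]]) ->
  hasGrid U d L N rho q ->
  exists U', [/\ U' `<=` B, #|` U'| <= #|` U| + 2 * size P &
    hasGrid U' d L N rho (q + size P)].
Proof.
elim: P U q => [|[x y] P IH] U q UB PB uP PU Pd grid.
  by exists U; rewrite muln0 !addn0.
move: uP PB PU; rewrite elements_cons /= inE negb_or => /and3P[/andP[xy xP] yP uP] PB PU.
have xB : x \in B by rewrite PB // inE eqxx.
have yB : y \in B by rewrite PB // !inE eqxx orbT.
have xU : x \notin U by rewrite PU // inE eqxx.
have yU : y \notin U by rewrite PU // !inE eqxx orbT.
have [D [/= yE DN Drho]] := Pd (x, y) (mem_head _ _).
have [|||||U' [h1 h2 h3]] := IH (addpair x y U) q.+1 _ _ uP.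
- apply/fsubsetP => z; rewrite addpairE => /or3P[/eqP ->//|/eqP ->//|]; exact: (fsubsetP UB).
- by move=> z zP; rewrite PB // !inE zP !orbT.
- move=> z zP; rewrite addpairE (negbTE (PU z _)) ?inE ?zP ?orbT // orbF negb_or.
  by apply/andP; split; apply/eqP => E; move: xP yP; rewrite -E zP.
- by move=> p pP; apply: Pd; rewrite inE pP orbT.
- have [p [x0 H]] := grid; exists p.+1, (x + x0) => i.
  rewrite leq_eqVlt ltnS => /orP[/eqP ->|iq].
    have [E [EN Em Ef]] := H q (leqnn q); exists (E + D); split.
    + by rewrite mulSn addnC leq_add.
    + by rewrite mulSn addnC -modnDm Em Drho modnDm.
    + move=> j jL; have -> : x + x0 + (E + D) + d * j = y + (x0 + E + d * j) by lia.
      by apply: fixed_sum_right => //; exact: Ef.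
  have [E [EN Em Ef]] := H i iq; exists E; split=> // j jL.
  rewrite -addnA -addnA addnA.
  have -> : x + x0 + (E + d * j) = x + (x0 + E + d * j) by lia.
  by apply: fixed_sum_left => //; exact: Ef.
exists U'; split=> //=; first by have := card_addpair x y U; card_lia.
by rewrite addnS -addSn.
Qed.

Lemma hasAP_refine P B U d L N rho :
  U `<=` B -> {subset elements P <= B} -> uniq (elements P) ->
  (forall z, z \in elements P -> z \notin U) ->
  (forall p, p \in P -> exists D, [/\ p.2 = p.1 + D, D <= N & D = rho %[mod d]]) ->
  size P = d -> 0 < d -> hasAP U d L ->
  exists U', [/\ U' `<=` B, #|` U'| <= #|` U| + 2 * d &
    hasAP U' (gcdn rho d) ((d %/ gcdn rho d) * (L - N))].
Proof.
move=> UB PB uP PU Pd sP d0 [p [x0 H]].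
have grid : hasGrid U d L N rho 0.
  exists p, x0 => i; rewrite leqn0 => /eqP ->; exists 0; split=> // j jL.
  by rewrite addn0; exact: H.
have [U' [h1 h2 h3]] := hasGrid_pairs UB PB uP PU Pd grid; rewrite sP add0n in h2 h3.
exists U'; split=> //; have [{H}p' [x1 H]] := h3.
set e := gcdn rho d; have e0 : 0 < e by rewrite gcdn_gt0 d0 orbT.
(* The start moves up by [d * N], an upper bound for the offset [E] to be subtracted; this costs [N]
   terms of the old progression, hence [L - N]. *)
exists p', (x1 + d * N) => w wL.
have [a ad /dvdnP[b bE]] := Bezoutr rho d0.
(* By Bezout [e] is congruent to [- a * rho], so [i] copies of [rho] represent [e * w] mod [d]. *)
pose i := ((d - a) * w) %% d.
have id_ : i < d by rewrite ltn_pmod.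
have [E [EN Em Ef]] := H i (ltnW id_).
have Ez : E = e * w %[mod d].
  rewrite Em -modnMml modn_mod modnMml; apply/eqP.
  rewrite -(eqn_modDr (a * rho * w)).
  have -> : (d - a) * w * rho + a * rho * w = d * (w * rho).
    have : (d - a) * (w * rho) + a * (w * rho) = d * (w * rho) by rewrite -mulnDl subnK // ltnW.
    lia.
  by rewrite -mulnDl bE modnMr [b * d]mulnC -mulnA modnMr.
have EdN : E <= d * N by apply: leq_trans EN _; rewrite leq_mul2r (ltnW id_) orbT.
have wd : e * w < d * (L - N).
  rewrite -{1}(divnK (dvdn_gcdr rho d)) -/e [_ %/ _ * _]mulnC -mulnA ltn_mul2l e0 /=.
  exact: wL.
have : d %| d * N + e * w - E.
  rewrite -eqn_mod_dvd; last by lia.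
  by rewrite -modnDml modnMr add0n eq_sym; apply/eqP.
move=> /dvdnP[j jE].
have -> : x1 + d * N + e * w = x1 + E + d * j by lia.
apply: Ef; rewrite -(ltn_pmul2l d0) [d * j]mulnC -jE.
by move: wd; rewrite mulnBr; lia.
Qed.

(** In each of [b] rounds more than [2 * b] elements are left, two of which differ by [d * j] with
    [2 * b <= j <= N < L]; so each round gains at least [2 * b]. *)
Lemma hasAP_congruent W U d L N b : (forall x, x \in W -> x <= N) ->
  (forall x, x \in W -> x \notin U) ->
  {in W &, forall x y, x = y %[mod d]} -> 0 < d -> 4 * b < #|` W| -> 0 < b -> N < L ->
  hasAP U d L -> hasAP (U `|` W) d (2 * b * b).
Proof.
move=> WN WU Wd d0 bW b0 NL ap.
have [||U' [h1 _ h3]] := @hasAP_rounds W (2 * b).+1 (2 * b) b U d L _ WU _ ap.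
- move=> V VW vV.
  have inj : {in V &, injective (fun x => x %/ d)}.
    move=> x y /(fsubsetP VW) xW /(fsubsetP VW) yW q.
    by rewrite (divn_eq x d) (divn_eq y d) q (Wd x y).
  have [||x' [y' [/mapP[x xV ->] /mapP[y yV ->] le]]] :=
    @spread_seq [seq x %/ d | x <- V] (2 * b).
  - by rewrite map_inj_in_uniq ?fset_uniq.
  - by rewrite size_map.
  have xW := fsubsetP VW _ xV; have yW := fsubsetP VW _ yV.
  exists x, y, (y %/ d - x %/ d); split=> //.
    rewrite {1}(divn_eq y d) {1}(divn_eq x d) (Wd x y) // mulnBr ![d * _]mulnC.
    by rewrite -addnA [_ %% _ + _]addnC addnA subnKC // leq_mul2r; apply/orP; right; card_lia.
  have arith X Y : X + 2 * b <= Y -> Y <= N -> 2 * b <= Y - X <= L.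
    by move: NL; clear; lia.
  exact: arith le (leq_trans (leq_div _ _) (WN y yW)).
- card_lia.
apply: hasAP_sub h1 _; apply: hasAP_le h3; card_lia.
Qed.

(** Strong induction on [d]. In the budget, [2 * d * d] provides the incongruent pairs, [4 * d] pays
    for all refinements since [d] at least halves each time and one refinement uses [2 * d]
    elements, and [4 * b] is reserved for the final congruence class. *)
Lemma hasAP_descent d B U L N b : U `<=` B -> (forall x, x \in B -> x <= N) -> 0 < d ->
  0 < b -> 2 * N < L -> #|` U| + 2 * d * d + 4 * d + 4 * b < #|` B| ->
  hasAP U d L -> exists2 e, 0 < e & hasAP B e (2 * b * b).
Proof.
elim/ltn_ind: d U L => d IH U L UB BN d0 b0 NL card ap.
have cardV : #|` U| + #|` B `\` U| = #|` B|.
  by rewrite cardfsDS // subnKC // fsubset_leq_card.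
pose Phi x y := (x < y) && (x != y %[mod d]).
have [[W [WV Wb Wd]]|H] : (exists W, [/\ W `<=` B `\` U, 4 * b < #|` W| &
      {in W &, forall x y, x = y %[mod d]}]) \/
    (forall W, W `<=` B `\` U -> 4 * b < #|` W| ->
      exists x y, [/\ x \in W, y \in W, x != y & Phi x y]).
  have [ex|nex] := boolp.pselect (exists W, [/\ W `<=` B `\` U, 4 * b < #|` W| &
      {in W &, forall x y, x = y %[mod d]}]); [by left|right=> W WV Wb].
  have [/hasP[x xW /hasP[y yW xy]]|] := boolP (has (fun x => has (Phi x) W) W).
    by exists x, y; split=> //; case/andP: xy => lt _; rewrite neq_ltn lt.
  move=> /hasPn H; exfalso; apply: nex; exists W; split=> // x y xW yW.
  have aux u v : u \in W -> v \in W -> u < v -> u = v %[mod d].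
    move=> uW vW lt; apply/eqP; apply: contraT => ne.
    by have /hasPn/(_ v vW) := H u uW; rewrite /Phi lt ne.
  by case: (ltngtP x y) => [/aux -> //|/aux <- //|->].
- exists d => //.
  have WB : W `<=` B by apply: fsubset_trans WV (fsubsetDl _ _).
  apply: (@hasAP_sub (U `|` W)); first by rewrite fsubUset UB.
  apply: (@hasAP_congruent _ _ _ L N) => //.
  + by move=> x xW; apply: BN; exact: (fsubsetP WB).
  + by move=> x /(fsubsetP WV); rewrite inE => /andP[].
  + card_lia.
have [|P [sP uP PV PhiP]] := @collect_pairs Phi _ (4 * b).+1 (d * d) H; first by card_lia.
pose key (p : nat * nat) := (p.2 - p.1) %% d.
have [||rho rhoP] := @pigeonhole_seq _ P key d d.-1.
- by move=> p _; rewrite ltn_pmod.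
- by rewrite sP ltn_pmul2l // ltn_predL.
pose P' := take d [seq p <- P | key p == rho].
have subP' : subseq P' P by apply: subseq_trans (take_subseq _ _) (filter_subseq _ _).
have sP' : size P' = d by rewrite size_takel // (leq_trans _ rhoP) // prednK.
have P'in p : p \in P' -> [/\ key p = rho, p.1 < p.2 & p.1 != p.2 %[mod d]].
  move=> /mem_take; rewrite mem_filter => /andP[/eqP kp /PhiP /andP[lt ne]].
  by split.
(* Incongruence of the pairs makes [gcdn rho d] a proper divisor of [d]. *)
have rho0 : ~~ (d %| rho).
  have : P' != [::] by rewrite -size_eq0 sP' -lt0n.
  case: P' P'in {sP' subP'} => // p P' /(_ p (mem_head _ _)) [<- lt ne] _.
  apply: contra ne; rewrite /key /dvdn modn_mod => dv.
  by rewrite eq_sym eqn_mod_dvd // ltnW.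
have [||||U' [h1 h2 h3]] := @hasAP_refine P' B U d L N rho UB _ _ _ _ sP' d0 ap.
- move=> z /(mem_subseq (subseq_elements subP')) /PV; rewrite inE => /andP[_].
  exact.
- exact: subseq_uniq (subseq_elements subP') uP.
- by move=> z /(mem_subseq (subseq_elements subP')) /PV; rewrite inE => /andP[].
- move=> p pP; have [kp lt ne] := P'in p pP; exists (p.2 - p.1); split.
  + by rewrite subnKC // ltnW.
  + apply: leq_trans (leq_subr _ _) _; apply: BN.
    have : p.2 \in elements P.
      apply: (mem_subseq (subseq_elements subP')); apply/flattenP.
      by exists [:: p.1; p.2]; [apply/mapP; exists p|rewrite !inE eqxx orbT].
    by move=> /PV; rewrite inE => /andP[].
  + by rewrite -kp /key modn_mod.
set e := gcdn rho d in h3.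
have e0 : 0 < e by rewrite gcdn_gt0 d0 orbT.
have /dvdnP[q qE] : e %| d by exact: dvdn_gcdr.
have q2 : 2 <= q.
  case: q qE => [|[|q]] // qE; first by move: d0; rewrite qE.
  by move: rho0; rewrite qE mul1n dvdn_gcdl.
have q_div : d %/ e = q by rewrite qE mulnK.
rewrite q_div in h3.
(* As [q >= 2] and [L > 2 * N], the new length [q * (L - N)] again exceeds [2 * N]. *)
apply: (IH e _ U' (q * (L - N))) => //; [nia|nia|].
have : 2 * e <= d by rewrite qE leq_mul2r q2 orbT.
move=> ed; have : 4 * (e * e) <= d * d by have := leq_mul ed ed; card_lia.
have : d <= d * d by rewrite leq_pmulr.
card_lia.
Qed.

(** Blocks of length [8 * G] are few compared with [B], so there are [8 * G * (16 * G)] disjoint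
    pairs with differences below [8 * G], and one difference occurs [16 * G] times. *)
Lemma hasAP_short_difference B N G b : (forall x, x \in B -> x <= N) ->
  16 * b <= #|` B| -> N <= 16 * G * b -> 256 * (G * G) <= b -> 0 < G ->
  exists U d, [/\ U `<=` B, #|` U| <= 32 * G, 0 < d < 8 * G & hasAP U d (16 * G)].
Proof.
move=> BN cardB NG Gb G0.
pose Phi x y := (x < y) && (y - x < 8 * G).
have G16 : 0 < 16 * G by rewrite muln_gt0.
have [||P [sP uP PB PhiP]] := @collect_pairs Phi B (N %/ (8 * G)).+2 (8 * G * (16 * G)).
- move=> W WB Wv.
  have [||||x [y [j [xW yW yE /andP[j1 jG]]]]] := @cell_pair W N 1 (8 * G) 1.
  + by move=> x /(fsubsetP WB); exact: BN.
  + by [].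
  + by rewrite muln_gt0.
  + by rewrite !mul1n.
  by exists x, y; split=> //; rewrite /Phi; move: yE j1 jG; clear; lia.
- have N8 : N %/ (8 * G) <= 2 * b.
    by rewrite -ltnS ltn_divLR ?muln_gt0 ?G0 //; move: NG G0; clear; lia.
  have G1 : 0 < G * G by rewrite muln_gt0 G0.
  by apply: leq_trans cardB; move: N8 Gb G1; clear; move: (N %/ _) => q; lia.
pose key (p : nat * nat) := p.2 - p.1.
have [||d dP] := @pigeonhole_seq _ P key (8 * G) (16 * G).-1.
- by move=> p /PhiP /andP[].
- by rewrite sP ltn_pmul2l ?muln_gt0 // ltn_predL.
set P0 := [seq _ <- _ | _] in dP.
pose P' := take (16 * G) P0.
have subP' : subseq P' P by apply: subseq_trans (take_subseq _ _) (filter_subseq _ _).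
have sP' : size P' = 16 * G by rewrite size_takel // (leq_trans _ dP) // prednK.
have P'd p : p \in P' -> 0 < d < 8 * G /\ p.2 = p.1 + d.
  move=> /mem_take; rewrite mem_filter => /andP[/eqP <- /PhiP /andP[lt ltG]].
  by rewrite /key ltG subn_gt0 lt subnKC // ltnW.
have db : 0 < d < 8 * G.
  have : 0 < size P' by rewrite sP'.
  by case: P' P'd {subP' sP'} => // p P'' H _; have [] := H p (mem_head _ _).
have [||||||U [UB Uc ap]] := @hasAP_pairs P' B fset0 d 1 (fsub0set _).
- by move=> z /(mem_subseq (subseq_elements subP')) /PB.
- exact: subseq_uniq (subseq_elements subP') uP.
- by move=> z _; rewrite inE.
- by move=> p /P'd[].
- by [].
(* The process starts from the empty set, whose only sum is a progression of length 1. *)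
- exists 0, 0 => j; rewrite ltnS leqn0 => /eqP ->; exists fset0; split=> //.
  by rewrite big_seq_fset0 muln0.
rewrite sP' cardfs0 add0n mulnA in Uc; rewrite sP' in ap.
by exists U, d; split=> //; apply: hasAP_le ap; exact: leq_addl.
Qed.

Lemma hasAP_cell_rounds B N d U L m t : (forall x, x \in B -> x <= N) -> U `<=` B ->
  0 < d -> 0 < L -> hasAP U d L -> #|` U| + 2 * t + m * (N %/ L + d) < #|` B| ->
  exists U', [/\ U' `<=` B, #|` U'| <= #|` U| + 2 * t & hasAP U' d (L + t * m)].
Proof.
move=> BN UB d0 L0 ap lt.
have cardV : #|` U| + #|` B `\` U| = #|` B|.
  by rewrite cardfsDS // subnKC // fsubset_leq_card.
have [|||U' [h1 h2 h3]] := @hasAP_rounds (B `\` U) (m * (N %/ L + d)).+1 m t U d L _ _ _ ap.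
- move=> W WV Wv.
  have [||||x [y [j [xW yW yE /andP[j1 jL]]]]] := @cell_pair W N d L m => //.
  + by move=> x /(fsubsetP WV); rewrite inE => /andP[_ /BN].
  + apply: leq_ltn_trans Wv; rewrite leq_mul2l; apply/orP; right.
    by rewrite mulnS addnC leq_add2r mulnC [d * L]mulnC divnMA leq_trunc_div.
  by exists x, y, j; rewrite j1 ltnW.
- by move=> z; rewrite inE => /andP[].
- by move: lt; rewrite -cardV -addnA -addnS leq_add2l [2 * t + _]addnC -addSn.
exists U'; split=> //; apply: fsubset_trans h1 _.
by rewrite fsubUset UB fsubsetDl.
Qed.

(** The length grows from [16 * G] to [2 * b] by [2 * b] rounds of gain 1, then by [2 * b] rounds of
    gain [16 * G] beyond [32 * G * b >= 2 * N], where the descent on the difference takes over. *)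
Lemma long_AP B N G b : (forall x, x \in B -> x <= N) -> 16 * b <= #|` B| ->
  N <= 16 * G * b -> 256 * (G * G) <= b -> 0 < G ->
  exists2 d, 0 < d & hasAP B d (2 * b * b).
Proof.
move=> BN cardB NG Gb G0.
have GG : G <= G * G by rewrite leq_pmulr.
have b0 : 0 < b by move: G0 GG Gb; clear; lia.
have G16 : 0 < 16 * G by rewrite muln_gt0.
have b2 : 0 < 2 * b by rewrite muln_gt0.
have [U0 [d [U0B U0c /andP[d0 dG] ap0]]] := hasAP_short_difference BN cardB NG Gb G0.
have [|U1 [U1B U1c ap1]] := @hasAP_cell_rounds B N d U0 (16 * G) 1 (2 * b) BN U0B d0 G16 ap0.
  apply: leq_trans cardB.
  have : N %/ (16 * G) <= b.
    by rewrite -ltnS ltn_divLR ?muln_gt0 ?G0 //; move: NG G0; clear; lia.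
  move: U0c dG GG Gb; clear; move: (N %/ _) (size _) => q c; lia.
have {}ap1 : hasAP U1 d (2 * b) by apply: hasAP_le ap1; move: b0; clear; lia.
have N2 : N %/ (2 * b) <= 8 * G.
  by rewrite -ltnS ltn_divLR ?muln_gt0 ?b0 //; move: NG b0; clear; lia.
have [|U2 [U2B U2c ap2]] :=
    @hasAP_cell_rounds B N d U1 (2 * b) (16 * G) (2 * b) BN U1B d0 b2 ap1.
  apply: leq_trans cardB.
  have : 16 * G * (N %/ (2 * b) + d) <= 16 * G * (16 * G).
    by rewrite leq_mul2l; apply/orP; right; move: N2 dG; clear; move: (N %/ _) => q; lia.
  move: U0c U1c b0 GG Gb; clear; move: (16 * G * (_ + _)) (size _) (size _) => q c c'; lia.
apply: (hasAP_descent U2B BN d0 b0 _ _ ap2).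
  by move: NG b0; clear; lia.
apply: leq_trans cardB.
have dd : d * d <= 8 * G * (8 * G) by apply: leq_mul; exact: ltnW.
move: U0c U1c U2c b0 GG Gb dG dd; clear; move: (size _) (size _) (size _) => c c' c''; lia.
Qed.

End LongProgressions.

(** * Few subset sums force a long progression *)

Section Inverse.
Local Open Scope fset_scope.
Local Open Scope nat_scope.

Lemma ex_min_int (r : seq int) : r != [::] ->
  exists2 a, a \in r & forall b, b \in r -> (a <= b)%R.
Proof.
elim: r => // a [|b r] IH _.
  by exists a; rewrite ?mem_head // => c; rewrite inE => /eqP ->.
have [//|c cr H] := IH _.
have [le|lt] := leP c a.
  exists c; first by rewrite inE cr orbT.
  by move=> x; rewrite inE => /orP[/eqP ->//|]; exact: H.
exists a; first exact: mem_head.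
move=> x; rewrite inE => /orP[/eqP ->//|/H xc]; exact: le_trans (ltW lt) xc.
Qed.

Lemma mem_msum_shift m a (r : seq int) x :
  (x \in msum m [seq (y - a)%R | y <- r]) = ((x + a *+ m)%R \in msum m r).
Proof.
elim: m x => [|m IH] x; first by rewrite !inE mulr0n addr0.
apply/msumSP/msumSP.
  move=> [_ [y [/mapP[c cr ->] ym ->]]]; exists c, (y + a *+ m)%R; rewrite -IH.
  by split=> //; rewrite mulrS; ring.
move=> [c [y [cr ym E]]]; exists (c - a)%R, (y - a *+ m)%R.
split; [exact: map_f|by rewrite IH subrK|].
by rewrite -[LHS](addrK (a *+ m.+1)%R) E mulrS; ring.
Qed.

Lemma card_msum_shift m a (r : seq int) :
  #|` msum m [seq (y - a)%R | y <- r]| = #|` msum m r|.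
Proof.
rewrite -(card_translate (- (a *+ m))%R (msum m r)).
by congr #|` _|; apply/fsetP => x; rewrite mem_msum_shift mem_translate opprK.
Qed.

Lemma sum_affine (a : int) h (T : seq nat) :
  (\sum_(i <- T) (a + (i * h)%N%:Z) = a *+ size T + h%:Z * (\sum_(i <- T) i)%N%:Z)%R.
Proof.
elim: T => [|i T IH]; first by rewrite !big_nil mulr0n mulr0 addr0.
by rewrite !big_cons IH /= mulrS PoszD PoszM; ring.
Qed.

(** After translating the minimum to [0], the first bound excludes growth by [3 ^ J], so all
    elements are multiples of some [h], and the second bounds the largest one divided by [h]. A
    progression found there is carried back, since all its sums have the same number [p] of terms
    and shift by the same [a *+ p]. *)
Lemma long_AP_of_small_msum (r : seq int) J G b : uniq r -> 16 * b <= size r ->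
  #|` msum (2 ^ J + 2 ^ J) r| < 3 ^ J * (size r).-1 ->
  #|` msum (2 ^ J + 2 ^ J) r| <= 2 ^ J * (16 * G * b) -> 256 * (G * G) <= b -> 0 < G ->
  exists x0 d : int, (0 < d)%R /\ forall j, j < 2 * b * b ->
    exists t, [/\ uniq t, {subset t <= r} & (\sum_(i <- t) i = x0 + d * j%:Z)%R].
Proof.
move=> ur br small1 small2 Gb G0.
have GG : 0 < G * G by rewrite muln_gt0 G0.
have sr : 2 < size r by apply: leq_trans br; move: GG Gb; clear; lia.
have [|a ar amin] := @ex_min_int r; first by rewrite -size_eq0; move: sr; case: size.
pose r' := [seq `|x - a|%N | x <- r].
have r'E x : x \in r -> (`|x - a|%N%:Z = x - a)%R.
  by move=> /amin; lia.
have ur' : uniq r'.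
  rewrite map_inj_in_uniq // => x y xr yr E.
  by have := r'E x xr; rewrite E r'E // => /addIr.
have sr' : size r' = size r by rewrite size_map.
have zr' : 0 \in r' by apply/mapP; exists a; rewrite ?subrr.
have [|N Nr' Nmax] := @ex_argmax_seq _ id r'; first by rewrite -size_eq0 sr'; move: sr; case: size.
have N2 : 1 < N.
  rewrite ltnNge; apply/negP => N1; move: sr; rewrite -sr' ltnNge.
  have -> // : size r' <= 2; rewrite -(size_iota 0 2); apply: uniq_leq_size => // y yr'.
  by rewrite mem_iota; have := Nmax y yr'; rewrite /= in N1 *; lia.
case: N Nr' Nmax N2 => [|[|n]] // Nr' Nmax _.
have mapE : [seq (y - a)%R | y <- r] = [seq Posz y | y <- r'].
  by rewrite /r' -map_comp; apply/eq_in_map => x xr /=; rewrite r'E.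
have memP y : (Posz y \in [seq (y - a)%R | y <- r]) = (y \in r').
  by rewrite mapE mem_map //; move=> ? ? [].
have [||||H|[h [h0 hN hr]]] := @msum_growth n [seq (y - a)%R | y <- r] _ _ _ _ J.
- by rewrite map_inj_uniq //; exact: addIr.
- by rewrite memP.
- by rewrite memP.
- by rewrite mapE => _ /mapP[y /Nmax yN ->]; rewrite /= in yN *; lia.
- by move: small1; rewrite ltnNge -(card_msum_shift _ a) -(size_map (fun y => y - a)%R r) H.
rewrite card_msum_shift in hN.
have hr' y : y \in r' -> h %| y by rewrite -memP => /hr; rewrite dvdzE.
pose B := [fset y %/ h | y in r'].
have memB y : y \in B -> y * h \in r'.
  by move=> /imfsetP[/= z zr ->]; rewrite divnK // hr'.
have cardB : #|` B| = size r.
  rewrite card_in_imfset /=.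
    by rewrite undup_id.
  by move=> y z yr zr E; rewrite -(divnK (hr' y yr)) E divnK // hr'.
have /dvdnP[N' NE] := hr' _ Nr'.
have N'b : N' <= 16 * G * b.
  rewrite -(leq_pmul2l (_ : 0 < 2 ^ J)) ?expn_gt0 //; apply: leq_trans small2.
  by rewrite -(leq_pmul2l h0) [h * (_ * N')]mulnCA [h * N']mulnC -NE.
have BN y : y \in B -> y <= N'.
  by move=> /memB /Nmax /=; rewrite NE leq_pmul2r.
have [|d d0 [p [x0 AP]]] := @long_AP B N' G b BN _ N'b Gb G0; first by rewrite cardB.
exists (a *+ p + h%:Z * x0%:Z)%R, (h%:Z * d%:Z)%R; split; first by rewrite mulr_gt0 //; lia.
move=> j /AP[T [TB Tp Tsum]].
exists [seq (a + (i * h)%:Z)%R | i <- T]; split.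
- rewrite map_inj_uniq ?fset_uniq // => x y /addrI [] /eqP.
  by rewrite eqn_pmul2r // => /eqP.
- move=> _ /mapP[i /(fsubsetP TB) /memB /mapP[x xr E] ->].
  by rewrite E r'E // addrC subrK.
- by rewrite big_map sum_affine Tsum Tp PoszD PoszM; ring.
Qed.

Lemma subset_sums_uniq (s t : seq int) : uniq t -> {subset t <= s} ->
  (\sum_(i <- t) i)%R \in subset_sums s.
Proof.
move=> ut ts; apply/subset_sums_count; exists t => // y.
by rewrite count_uniq_mem //; case: (boolP (y \in t)) => // /ts; rewrite -has_pred1 has_count.
Qed.

Lemma subset_sums_inverse (s : seq int) M e J G b : uniq s -> #|` subset_sums s| <= M ->
  M < 2 ^ e -> 2 * (2 ^ J + 2 ^ J) * e <= (size s)./2 -> 16 * b <= size s - (size s)./2 ->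
  2 * M <= 2 ^ J * (16 * G * b) -> 2 * M <= 3 ^ J * (size s - (size s)./2).-1 ->
  256 * (G * G) <= b -> 0 < G ->
  exists x0 d : int, (0 < d)%R /\ forall j, j < 2 * b * b ->
    (x0 + d * j%:Z)%R \in subset_sums s.
Proof.
move=> us sM Me Je bs M1 M2 Gb G0.
have [u [r [sur su H]]] := small_msum (leq_ltn_trans sM Me).
have {H} lt : #|` msum (2 ^ J + 2 ^ J) r| < 2 * M.
  by apply: leq_trans (H _ Je) _; rewrite leq_mul2l sM.
have sr : size r = size s - (size s)./2 by rewrite -su (perm_size sur) size_cat addKn.
have rs : {subset r <= s}.
  by move=> x xr; rewrite (perm_mem sur) mem_cat xr orbT.
have ur : uniq r by move: us; rewrite (perm_uniq sur) cat_uniq => /and3P[].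
have [|||x0 [d [d0 AP]]] := @long_AP_of_small_msum r J G b ur _ _ _ Gb G0.
- by rewrite sr.
- by rewrite sr; exact: leq_trans lt M2.
- exact: leq_trans (ltnW lt) M1.
exists x0, d; split=> // j /AP[t [ut tr <-]].
by apply: subset_sums_uniq => // y /tr /rs.
Qed.

End Inverse.

(** * Union bound over encoded cubes *)

Section RandomColoring.
Local Open Scope fset_scope.
Local Open Scope nat_scope.

Lemma card_subset_sums_cons_le (a : int) s :
  #|` subset_sums (a :: s)| <= 2 * #|` subset_sums s|.
Proof.
rewrite card_subset_sums_cons mul2n -addnn leq_add2l -(growth_card _ a).
exact: leq_addr.
Qed.

(** Each further element at most doubles the set, so the first tail exceeding [M] is within
    [2 * M]. *)
Lemma ex_medium_subset_sums (s : seq int) M : 0 < M -> M < #|` subset_sums s| ->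
  exists t, [/\ subseq t s, M < #|` subset_sums t| & #|` subset_sums t| <= 2 * M].
Proof.
move=> M0; elim: s => [|a s IH] lt; first by move: lt; rewrite /= cardfs1 ltnNge M0.
have [/IH[t [ts t1 t2]]|le] := ltnP M #|` subset_sums s|.
  by exists t; split=> //; exact: subseq_trans ts (subseq_cons _ _).
exists (a :: s); split=> //; apply: leq_trans (card_subset_sums_cons_le a s) _.
by rewrite leq_mul2l le.
Qed.

(** An element that is not a difference of subset sums of [B] translates them to a disjoint set, so
    joining it to [B] doubles their number. *)
Lemma ex_dissociated (s : seq int) : exists B,
  [/\ subseq B s, #|` subset_sums B| = 2 ^ size B &
    forall a, a \in s -> exists x y,
      [/\ x \in subset_sums B, y \in subset_sums B & a = (x - y)%R]].
Proof.
elim: s => [|a s [B [Bs cB HB]]]; first by exists [::]; rewrite /= cardfs1.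
have [[x [y [xB yB aE]]]|nex] := boolp.pselect (exists x y,
    [/\ x \in subset_sums B, y \in subset_sums B & a = (x - y)%R]).
  exists B; split=> //; first exact: subseq_trans Bs (subseq_cons _ _).
  by move=> c; rewrite inE => /orP[/eqP ->|/HB //]; exists x, y.
exists (a :: B); split; first by rewrite /= eqxx.
  rewrite card_subset_sums_cons expnS mul2n -addnn -cB; congr (_ + _).
  rewrite -[RHS](growth_card _ a) -[LHS]addn0; congr (_ + _); apply/esym/eqP.
  rewrite cardfs_eq0; apply/eqP/fsetP => y; rewrite !inE mem_translate.
  apply/negP => /andP[h1 h2]; apply: nex; exists y, (y - a)%R; split=> //.
  by rewrite subKr.
move=> c; rewrite inE => /orP[/eqP ->|/HB[x [y [xB yB cE]]]].
  exists a, 0%R; rewrite subset_sums0 subr0; split=> //.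
  by rewrite /= inE mem_translate subrr subset_sums0 orbT.
by exists x, y; rewrite /= !inE xB yB.
Qed.

Lemma subset_sums_indicator (B : seq int) e x : size B <= e -> x \in subset_sums B ->
  exists f : nat -> bool, x = (\sum_(i < e) (f i)%:Z * nth 0 B i)%R.
Proof.
elim: B e x => [|a B IH] e x.
  rewrite inE => _ /eqP ->; exists xpred0; rewrite big1 // => i _.
  by rewrite mul0r.
case: e => // e Be; rewrite /= inE mem_translate => /orP[] /(IH e _ Be)[f fE].
  exists (fun i => if i is j.+1 then f j else false).
  by rewrite big_ord_recl mul0r add0r fE; apply: eq_bigr => i _.
exists (fun i => if i is j.+1 then f j else true).
rewrite big_ord_recl mul1r /= -[LHS](subrK a) addrC fE; congr (_ + _)%R.
Qed.

Lemma subset_sums_nseq0 m s : subset_sums (s ++ nseq m 0%R) = subset_sums s.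
Proof.
rewrite (perm_subset_sums (permEl (perm_catC _ _))).
elim: m => //= m ->; apply/fsetP => x.
by rewrite inE mem_translate subr0 orbb.
Qed.

Lemma card_constant_on n (T : {set 'I_n}) (b : bool) :
  #|[set f : {ffun 'I_n -> bool} | [forall i in T, f i == b]]| * 2 ^ #|T| = 2 ^ n.
Proof.
have -> : #|[set f : {ffun 'I_n -> bool} | [forall i in T, f i == b]]| =
    #|family (fun i : 'I_n => if i \in T then pred1 b else predT)|.
  apply: eq_card => f; rewrite inE; apply/forall_inP/familyP => H i.
    by case: ifP => // iT; rewrite inE H.
  by move=> iT; have := H i; rewrite iT inE.
rewrite card_family foldrE big_map big_enum /=.
rewrite (eq_bigr (fun i => if i \notin T then 2 else 1)); last first.
  by move=> i _; case: (i \in T); [exact: card1|exact: card_bool].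
rewrite -big_mkcond /= prod_nat_const -expnD.
have -> : #|[pred i | i \notin T]| = #|~: T| by apply: eq_card => i; rewrite !inE.
by rewrite addnC cardsC card_ord.
Qed.

(** A fraction [2 ^ -M] or less of the colorings is constant of a given color on [T c]; there are
    [#|C| * 2] such events. *)
Lemma ex_nonconstant_coloring n M (C : finType) (T : C -> {set 'I_n}) :
  #|C| * 2 < 2 ^ M -> exists f : {ffun 'I_n -> bool}, forall c, M <= #|T c| ->
    exists i j, [/\ i \in T c, j \in T c & f i != f j].
Proof.
move=> lt.
pose bad (cb : C * bool) := [set f : {ffun 'I_n -> bool} |
  (M <= #|T cb.1|) && [forall i in T cb.1, f i == cb.2]].
have badc cb : #|bad cb| * 2 ^ M <= 2 ^ n.
  case: cb => c b; have [le|gt] := leqP M #|T c|.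
    rewrite -(card_constant_on (T c) b) leq_mul ?leq_exp2l //.
    by apply/subset_leq_card/subsetP => f; rewrite !inE => /andP[].
  have -> : #|bad (c, b)| = 0; last by [].
  by apply/eqP; rewrite cards_eq0; apply/eqP/setP => f; rewrite !inE leqNgt gt.
have [f fgood|H] := pickP (fun f : {ffun 'I_n -> bool} => [forall cb, f \notin bad cb]).
  exists f => c Mc; have /existsP[i] : [exists i, i \in T c].
    apply: contraT; rewrite negb_exists => /forallP H.
    have /forallP/(_ (c, true)) := fgood; rewrite inE Mc /=.
    by case/negP; apply/forall_inP => i; rewrite (negbTE (H i)).
  move=> iT; have /forallP/(_ (c, f i)) := fgood; rewrite inE Mc /=.
  rewrite negb_forall_in => /exists_inP[j jT fj].
  by exists i, j; split=> //; rewrite eq_sym.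
have : 2 ^ n <= \sum_(cb : C * bool) #|bad cb|.
  have -> : 2 ^ n = \sum_(f : {ffun 'I_n -> bool}) 1.
    by rewrite sum1_card card_ffun card_bool card_ord.
  have -> : \sum_(cb : C * bool) #|bad cb| =
      \sum_(f : {ffun 'I_n -> bool}) \sum_(cb : C * bool) (f \in bad cb).
    rewrite exchange_big /=; apply: eq_bigr => cb _; rewrite -sum1_card big_mkcond /=.
    by apply: eq_bigr => f _; case: ifP.
  apply: leq_sum => f _; have /negbT := H f; rewrite negb_forall => /existsP[cb].
  by rewrite negbK => fb; rewrite (bigD1 cb) //= fb.
move=> le; suff : 2 ^ n * 2 ^ M <= #|C| * 2 * 2 ^ n.
  by rewrite mulnC leq_pmul2r ?expn_gt0 // leqNgt lt.
apply: (@leq_trans ((\sum_(cb : C * bool) #|bad cb|) * 2 ^ M)); first by rewrite leq_mul2r le orbT.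
have -> : #|C| * 2 = #|{: C * bool}| by rewrite card_prod card_bool.
rewrite big_distrl /= -sum_nat_const.
by apply: leq_sum => cb _; exact: badc.
Qed.

Section Codes.
Variables n e k : nat.

Let point (i : 'I_n) : int := Posz i.+1.

(** The base point, the base point plus each of [e] generators, and for each of [k] terms two bits
    per generator, whose difference is its coefficient. Storing translated generators keeps all
    entries in [[n]]. *)
Definition code := ('I_n * {ffun 'I_e -> 'I_n} *
  {ffun 'I_k -> {ffun 'I_e -> bool * bool}})%type.

Lemma card_code : #|{: code}| = n ^ e.+1 * 4 ^ (e * k).
Proof.
rewrite !card_prod !card_ffun !card_ord card_prod card_bool.
by rewrite expnS expnM.
Qed.

Definition code_terms (c : code) : seq int :=
  [seq (\sum_(i < e) ((c.2 l i).1%:Z - (c.2 l i).2%:Z) * (point (c.1.2 i) - point c.1.1))%R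
     | l <- enum 'I_k].

Definition code_points (c : code) : {set 'I_n} :=
  [set i | (point i - point c.1.1)%R \in subset_sums (code_terms c)].

Definition ord_of_int (i0 : 'I_n) (z : int) : 'I_n := insubd i0 (`|z|.-1).

Lemma ord_of_intK i0 z : (1 <= z <= n%:Z)%R -> point (ord_of_int i0 z) = z.
Proof.
move=> zn; have zlt : `|z|.-1 < n by lia.
by rewrite /point /ord_of_int insubdK //; lia.
Qed.

(** Pass to a part [t] of [s] with at most [2 * M] subset sums; its dissociated part [B] then has
    [2 ^ size B < 2 ^ e.+1], and it generates all of [t]. *)
Lemma ex_code x0 (s : seq int) M : 0 < M -> 2 * M < 2 ^ e.+1 -> size s <= k ->
  (forall y, y \in subset_sums s -> 1 <= x0 + y <= n%:Z)%R -> M < #|` subset_sums s| ->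
  exists c : code, M < #|code_points c| /\ forall i, i \in code_points c ->
    (point i - x0)%R \in subset_sums s.
Proof.
move=> M0 Me sk sn Ms.
have [t [ts t1 t2]] := ex_medium_subset_sums M0 Ms.
have [B [Bt cB HB]] := ex_dissociated t.
have subS u v : subseq u v -> subset_sums u `<=` subset_sums v.
  by move=> uv; apply: sub_subset_sums => y; exact: leq_count_subseq.
have Be : size B <= e.
  rewrite -ltnS -(ltn_exp2l _ _ (isT : 1 < 2)) -cB; apply: leq_ltn_trans Me.
  exact: leq_trans (fsubset_leq_card (subS _ _ Bt)) t2.
have x0n : (1 <= x0 <= n%:Z)%R by have := sn _ (subset_sums0 s); rewrite addr0.
have n0 : `|x0|.-1 < n by lia.
pose i0 := Ordinal n0; pose o := ord_of_int i0.
have oK z : (1 <= z <= n%:Z)%R -> point (o z) = z by exact: ord_of_intK.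
(* Beyond the end of [B] the default [0] encodes the base point itself. *)
have nthB i : (1 <= x0 + nth 0%R B i <= n%:Z)%R.
  have [iB|iB] := ltnP i (size B); last by rewrite nth_default // addr0.
  apply: sn; apply: (fsubsetP (subS _ _ (subseq_trans Bt ts))).
  apply/subset_sumsP; exists [:: nth 0%R B i]; last by rewrite big_seq1.
  by rewrite sub1seq mem_nth.
have [f fE] : exists f : 'I_k -> {ffun 'I_e -> bool * bool}, forall l : 'I_k,
    nth 0%R t l = (\sum_(i < e) ((f l i).1%:Z - (f l i).2%:Z) * nth 0 B i)%R.
  apply: (@fin_all_exists _ (fun=> {ffun 'I_e -> bool * bool}) (fun (l : 'I_k) g =>
    nth 0%R t l = \sum_(i < e) ((g i).1%:Z - (g i).2%:Z) * nth 0 B i)%R) => l.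
  have [x [y [xB yB lE]]] : exists x y,
      [/\ x \in subset_sums B, y \in subset_sums B & nth 0%R t l = (x - y)%R].
    have [lt|le] := ltnP l (size t); first by apply: HB; rewrite mem_nth.
    by exists 0%R, 0%R; rewrite subset_sums0 nth_default // subr0.
  have [fx xE] := subset_sums_indicator Be xB; have [fy yE] := subset_sums_indicator Be yB.
  exists [ffun i : 'I_e => (fx i, fy i)]; rewrite lE xE yE -sumrB.
  by apply: eq_bigr => i _; rewrite ffunE mulrBl.
pose c : code := ((o x0, [ffun i : 'I_e => o (x0 + nth 0 B i)%R]), [ffun l => f l]).
have cE : code_terms c = t ++ nseq (k - size t) 0%R.
  have tk : size t <= k by apply: leq_trans (size_subseq ts) sk.
  apply: (@eq_from_nth _ 0%R).
    by rewrite size_map size_cat size_nseq subnKC // -cardE card_ord.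
  rewrite size_map -cardE card_ord => l lk.
  rewrite (nth_map (Ordinal lk)) -?cardE ?card_ord //.
  have -> : nth (Ordinal lk) (enum 'I_k) l = Ordinal lk.
    by apply: val_inj; rewrite /= nth_enum_ord.
  transitivity (nth 0%R t l).
    rewrite (fE (Ordinal lk)); apply: eq_bigr => i _.
    rewrite !ffunE; congr (_ * _)%R; rewrite !oK //.
    by rewrite [(x0 + _)%R]addrC addrK.
  rewrite nth_cat; case: ltnP => // le.
  by rewrite nth_nseq if_same nth_default.
have pc : point c.1.1 = x0 by exact: oK.
have memc i : (i \in code_points c) = ((point i - x0)%R \in subset_sums t).
  by rewrite inE cE subset_sums_nseq0 pc.
exists c; split=> [|i]; last by rewrite memc; exact: (fsubsetP (subS _ _ ts)).
apply: (leq_trans t1); rewrite -(size_map (fun y => o (x0 + y)%R)).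
have okt y : y \in subset_sums t -> (1 <= x0 + y <= n%:Z)%R.
  by move=> yt; apply: sn; exact: (fsubsetP (subS _ _ ts)).
have u : uniq [seq o (x0 + y)%R | y <- subset_sums t].
  rewrite map_inj_in_uniq ?fset_uniq // => y z /okt yt /okt zt E.
  by have := oK _ yt; rewrite E oK // => /addrI.
rewrite -(card_uniqP u); apply/subset_leq_card/subsetP => i /mapP[y yt ->].
by rewrite memc oK ?okt // [(x0 + y)%R]addrC addrK.
Qed.

End Codes.

Lemma ex_coloring_no_large_cube n e k M : 0 < M -> 2 * M < 2 ^ e.+1 ->
  n ^ e.+1 * 4 ^ (e * k) * 2 < 2 ^ M.+1 ->
  exists g : int -> bool, forall x0 (s : seq int), size s <= k ->
    (forall y, y \in subset_sums s -> 1 <= x0 + y <= n%:Z)%R ->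
    M < #|` subset_sums s| ->
    exists y z, [/\ y \in subset_sums s, z \in subset_sums s & g (x0 + y)%R != g (x0 + z)%R].
Proof.
move=> M0 Me count.
case: n count => [|n] count.
  exists xpredT => x0 s _ /(_ 0%R (subset_sums0 s)); lia.
have [f fP] := @ex_nonconstant_coloring n.+1 M.+1 (code n.+1 e k)
  (@code_points n.+1 e k) (ltac:(by rewrite card_code)).
exists (fun z => f (ord_of_int ord0 z)) => x0 s sk sn Ms.
have [c [Mc cs]] := ex_code M0 Me sk sn Ms.
have [i [j [iT jT fij]]] := fP c Mc.
exists (Posz i.+1 - x0)%R, (Posz j.+1 - x0)%R; split; [exact: cs|exact: cs|].
have oE (l : 'I_n.+1) : ord_of_int ord0 (x0 + (Posz l.+1 - x0))%R = l.
  rewrite addrC subrK; apply: val_inj; rewrite /ord_of_int insubdK //.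
  exact: ltn_ord.
by rewrite !oE.
Qed.

End RandomColoring.

(** * The product coloring and the choice of parameters *)

Section Assembly.
Local Open Scope nat_scope.

Lemma vdW_le k r n : vdW_property k r n -> vdW k r <= n.
Proof. by move=> H; rewrite /vdW; case: ex_minnP => m _; apply; exact/boolp.asboolP. Qed.

Lemma cube_property_hilbert k r : cube_property k r (hilbert k r).
Proof. by rewrite /hilbert; case: ex_minnP => m /boolp.asboolP. Qed.

Lemma restricted_sumset_subset_sums (A : {fset int}) y :
  y \in subset_sums (enum_fset A) -> restricted_sumset A y.
Proof.
move=> /subset_sumsP[t tA ->]; have ut : uniq t by exact: subseq_uniq tA (fset_uniq A).
exists [fset x in t]%fset => /=.
  by apply/fsubsetP => x; rewrite inE => /(mem_subseq tA).
by apply: perm_big; apply: uniq_perm => //; [exact: fset_uniq|move=> x; rewrite inE].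
Qed.

(* Color each point by the pair of its color in a 2-coloring without long
   progressions and its color in one without large monochromatic cubes. *)
Lemma vdW_le_of_cube_property k L n M e :
  (forall s : seq int, uniq s -> size s = k -> #|` subset_sums s|%fset <= M ->
     exists x0 d : int, (0 < d)%R /\ forall j, j < L ->
       (x0 + d * j%:Z)%R \in subset_sums s) ->
  0 < M -> 2 * M < 2 ^ e.+1 -> n ^ e.+1 * 4 ^ (e * k) * 2 < 2 ^ M.+1 ->
  cube_property k 4 n -> vdW L 2 <= n.
Proof.
move=> inverse M0 Me count cube; apply: vdW_le => f1.
have [g gP] := ex_coloring_no_large_cube M0 Me count.
pose f (z : int) : 'I_4 := inord (f1 z + 2 * g z).
have fE y z : f y = f z -> f1 y = f1 z /\ g y = g z.
  move=> /(congr1 val); have b x : f1 x + 2 * g x < 4.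
    by have := ltn_ord (f1 x); case: (g x) => /=; lia.
  rewrite /= !inordK ?b // => E; have := ltn_ord (f1 y); have := ltn_ord (f1 z).
  move=> h1 h2; have gE : g y = g z.
    by move: E h1 h2; clear; case: (g y); case: (g z) => //=; lia.
  by split=> //; apply: val_inj; move: E; rewrite gE => /addIn.
have [i [Q [x0 [A [Ak ->]]] QS]] := cube f.
have inS y : y \in subset_sums (enum_fset A) -> (1 <= x0 + y <= n%:Z)%R /\ f (x0 + y)%R = i.
  by move=> /restricted_sumset_subset_sums yA; apply: QS; exists y.
have [big|small] := ltnP M #|` subset_sums (enum_fset A)|%fset.
  have [||y [z [yA zA]]] := gP x0 (enum_fset A) _ _ big.
  - by rewrite Ak.
  - by move=> y /inS[].
  have [_ fy] := inS y yA; have [_ fz] := inS z zA.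
  by have [_ ->] := fE _ _ (etrans fy (esym fz)); rewrite eqxx.
have [x1 [d [d0 AP]]] := inverse (enum_fset A) (fset_uniq A) Ak small.
exists (f1 (x0 + 0)%R), (x0 + x1)%R, d; split=> // _ [j /= jL <-].
have [h1 h2] := inS _ (AP j jL); have [_ h3] := inS 0%R (subset_sums0 _).
rewrite -addrA; split=> //.
by have [] := fE _ _ (etrans h2 (esym h3)).
Qed.

Lemma sqr_le_exp2 q : 4 <= q -> q * q <= 2 ^ q.
Proof.
elim: q => // q IH; rewrite leq_eqVlt => /orP[/eqP <- //|]; rewrite ltnS => q4.
rewrite expnS; have := IH q4; nia.
Qed.

Lemma linear_le_exp2 D l : 0 < D -> D * (3 * D + 10) <= l -> 3 * l + 5 <= 2 ^ (l %/ D).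
Proof.
move=> D0 lD; set q := l %/ D.
have q0 : 3 * D + 10 <= q by rewrite leq_divRL // mulnC.
have lq : l < q.+1 * D by rewrite -ltn_divLR.
apply: leq_trans (sqr_le_exp2 _); last by lia.
have : (3 * D + 10) * q <= q * q by rewrite leq_mul2r q0 orbT.
nia.
Qed.

(** Rests on [2 ^ 11 = 2048 <= 2187 = 3 ^ 7], with [J] rounded down to a multiple of 7 at a loss of
    at most 6. *)
Lemma exp2_le_exp3 J m : 7 * m <= 11 * (J - 6) -> 2 ^ m <= 3 ^ J.
Proof.
move=> le; apply: (@leq_trans (2 ^ (11 * (J %/ 7)))).
  rewrite leq_exp2l //; have := divn_eq J 7; have := ltn_pmod J (isT : 0 < 7); lia.
apply: (@leq_trans (3 ^ (7 * (J %/ 7)))).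
  by rewrite !expnM; case: (J %/ 7) => // q; rewrite leq_exp2r.
rewrite leq_exp2l //; have := divn_eq J 7; lia.
Qed.

(** Here [2 ^ l] approximates [k], [2 ^ mu] absorbs the logarithmic factors, [G = 2 ^ ga] is of
    order [k^(1/2)], [b = 2 ^ (l - 5)], and [M] is of order [k^(5/2) / 2 ^ mu]. The bound
    [2 * ga <= l - 13] is [256 * G^2 <= b], and [2 ^ (2 * l - 9)] is [2 * b * b]. *)
Lemma vdW_le_hilbert l mu ga J k L : 1000 <= l -> 3 * l + 5 <= 2 ^ mu -> 100 * mu <= l ->
  2 * ga <= l - 13 -> l - 14 <= 2 * ga -> J + 3 + mu = l ->
  2 ^ l <= k < 2 ^ l.+1 -> L <= 2 ^ (2 * l - 9) ->
  hilbert k 4 <= 2 ^ 2 ^ (2 * l - 6 - 2 * mu + ga) ->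
  vdW L 2 <= hilbert k 4.
Proof.
move=> l1000 mu_exp mu_le ga_le ga_ge JE /andP[kl kl'] Ll hil.
have expk : 2 ^ l = 2 * (2 * 2 ^ (l - 2)).
  by rewrite -!expnS; congr (2 ^ _); move: l1000; clear; lia.
have expl : 2 ^ (l - 1) = 2 * 2 ^ (l - 2).
  by rewrite -!expnS; congr (2 ^ _); move: l1000; clear; lia.
have pos : 0 < 2 ^ (l - 2) by rewrite expn_gt0.
have half1 : 2 ^ (l - 1) <= k./2.
  by rewrite expl; move: kl; rewrite expk; clear; move: (2 ^ _) => p; lia.
have half2 : 2 ^ (l - 1) <= k - k./2.
  by apply: leq_trans half1 _; clear; lia.
have half3 : 2 ^ (l - 2) <= (k - k./2).-1.
  by move: half2; rewrite expl; move: pos; clear; move: (2 ^ _) (k - _) => p q; lia.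
pose M := 2 ^ (J + (l - 2) + ga).
have ME : 2 * M = 2 ^ J * (16 * 2 ^ ga * 2 ^ (l - 5)).
  rewrite /M -[16]/(2 ^ 4) -expnS -!expnD.
  by congr (2 ^ _); move: l1000; clear; lia.
apply: (@vdW_le_of_cube_property k L (hilbert k 4) M (3 * l + 3)).
- move=> s us sk sM.
  have [|||||||x0 [d [d0 AP]]] :=
    @subset_sums_inverse s M (3 * l + 3) J (2 ^ ga) (2 ^ (l - 5)) us sM.
  + by rewrite ltn_exp2l //; move: JE ga_le l1000; clear; lia.
  + rewrite sk; apply: leq_trans half1.
    have -> : 2 * (2 ^ J + 2 ^ J) = 2 ^ (J + 2) by rewrite expnD addnn -muln2 mulnC -mulnA.
    apply: (@leq_trans (2 ^ (J + 2) * 2 ^ mu)).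
      by rewrite leq_mul2l; apply/orP; right; move: mu_exp; clear; move: (2 ^ _) => p; lia.
    by rewrite -expnD leq_exp2l //; move: JE; clear; lia.
  + rewrite sk -[16]/(2 ^ 4) -expnD.
    by have -> : 4 + (l - 5) = l - 1 by move: l1000; clear; lia.
  + by rewrite ME.
  + rewrite sk; apply: (@leq_trans (2 ^ (J + 1 + ga) * 2 ^ (l - 2))).
      by rewrite -expnS -expnD leq_exp2l //; clear; lia.
    apply: leq_mul half3; apply: exp2_le_exp3.
    by move: JE mu_le ga_le l1000; clear; lia.
  + by rewrite -[256]/(2 ^ 8) -!expnD leq_exp2l //; move: ga_le l1000; clear; lia.
  + by rewrite expn_gt0.
  exists x0, d; split=> // j jL; apply: AP; apply: leq_trans jL _; apply: leq_trans Ll _.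
  by rewrite -expnS -expnD leq_exp2l //; move: l1000; clear; lia.
- by rewrite expn_gt0.
- by rewrite -expnS ltn_exp2l //; move: JE ga_le l1000; clear; lia.
- set Y := 2 ^ (2 * l - 6 - 2 * mu + ga) in hil.
  set e := 3 * l + 3.
  apply: (@leq_ltn_trans ((2 ^ Y) ^ e.+1 * 4 ^ (e * k) * 2)).
    by rewrite !leq_mul2r leq_exp2r // hil !orbT.
  rewrite -[4]/(2 ^ 2) -!expnM -expnD -expnSr ltn_exp2l // ltnS.
  have e1 : e.+1 < 2 ^ mu by apply: leq_trans mu_exp; rewrite /e; clear; lia.
  (* One factor [2 ^ mu] beats the [e.+1] points of a code; as [2 * k <= Y], the remaining factor 2
     covers its coefficient bits. *)
  have MY : M = 2 ^ mu * (2 * Y).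
    rewrite /M /Y -expnS -expnD; congr (2 ^ _).
    by move: JE mu_le ga_le l1000; clear; lia.
  have k2 : 2 * k <= Y.
    apply: (@leq_trans (2 ^ l.+2)); first by rewrite (expnS 2 l.+1) leq_mul2l ltnW.
    by rewrite leq_exp2l //; move: mu_le ga_ge l1000; clear; lia.
  have Y0 : 0 < Y by rewrite expn_gt0.
  clearbody Y e; rewrite MY; apply: (@leq_trans (e.+2 * (2 * Y))); last first.
    by rewrite leq_mul2r e1 orbT.
  have : e * (2 * k) <= e * Y by rewrite leq_mul2l k2 orbT.
  have -> : 2 * (e * k) = e * (2 * k) by rewrite mulnCA.
  move: Y0; clear; move: (e * (2 * k)) => q; nia.
- exact: cube_property_hilbert.
Qed.

End Assembly.

(** * Passage to real exponents *)

Local Open Scope ring_scope.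

Lemma natr_absz_floor_le (R : realType) (x : R) : 0 <= x -> `|Num.floor x|%N%:R <= x.
Proof.
by move=> x0; rewrite natr_absz ger0_norm ?floor_ge0 // ge_floor.
Qed.

(** As [E >= 5 * l / 2 - 13 - 2 * mu], it suffices that [eps * l >= 31 / 2 + 2 * mu]; the hypotheses
    bound both [31 / 2] and [2 * mu] by [eps * l / 2]. *)
Lemma powR_le_pow2 (R : realType) (eps : R) (D l k E mu ga : nat) : 0 < eps <= 1 ->
  4 <= eps * D%:R -> 31 <= eps * l%:R -> (mu * D <= l)%N -> (k < 2 ^ l.+1)%N ->
  (E + 6 + 2 * mu = 2 * l + ga)%N -> (l <= 2 * ga + 14)%N ->
  k%:R `^ (5 / 2 - eps) <= (2 ^ E)%:R :> R.
Proof.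
move=> /andP[e0 e1] eD el muD kl EE gal.
have a0 : 0 <= 5 / 2 - eps by lra.
apply: (@le_trans _ _ ((2 `^ l.+1%:R) `^ (5 / 2 - eps))).
  apply: ge0_ler_powR => //; rewrite ?nnegrE ?powR_ge0 //.
  by rewrite powR_mulrn // -natrX ler_nat ltnW.
rewrite -powRrM natrX -powR_mulrn //; apply: ler_powR; first by lra.
have h1 : eps * (mu%:R * D%:R) <= eps * l%:R by rewrite -natrM ler_wpM2l ?ler_nat // ltW.
have h2 : 4 * mu%:R <= eps * D%:R * mu%:R by rewrite ler_wpM2r.
have h3 : E%:R + 6 + 2 * mu%:R = 2 * l%:R + ga%:R :> R by rewrite -!natrM -!natrD EE.
have h4 : l%:R <= 2 * ga%:R + 14 :> R by rewrite -natrM -natrD ler_nat.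
rewrite -natr1; move: el h1 h2 h3 h4; move: (l%:R) (mu%:R) (ga%:R) (E%:R) (D%:R).
move=> x m g E' D' el h1 h2 h3 h4.
have h5 : 4 * m <= eps * x by apply: le_trans h2 _; apply: le_trans h1; lra.
lra.
Qed.

Theorem theorem3 (R : realType) (eps : R) (heps : 0 < eps) :
  exists2 c : R, 0 < c &
    forall k : nat, (3 <= k)%N ->
      Num.min (vdW `|Num.floor (c * k%:R ^+ 2)|%N 2)%:R
              (2 `^ (k%:R `^ (5 / 2 - eps)))
      <= (hilbert k 4)%:R.
Proof.
pose eps' := Num.min eps 1.
have eps'0 : 0 < eps' by rewrite lt_min heps ltr01.
have eps'1 : eps' <= 1 by rewrite ge_min lexx orbT.
have eps'e : eps' <= eps by rewrite ge_min lexx.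
pose D := (100 + Num.bound (4 / eps'))%N.
have eD : 4 <= eps' * D%:R.
  rewrite mulrC -ler_pdivrMr // ltW // (lt_le_trans (archi_boundP _)) //.
    by rewrite divr_ge0 // ltW.
  by rewrite ler_nat leq_addl.
pose l0 := (D * (3 * D + 10) + Num.bound (31 / eps'))%N.
(* For [k < 2 ^ l0] this makes the progression length [0]; otherwise the 11 turns
   [k * k < 2 ^ (2 * l + 2)] into a length of at most [2 ^ (2 * l - 9)]. *)
pose c : R := ((2 ^ (2 * l0 + 11))%N%:R)^-1.
have X0 : (0 : R) < (2 ^ (2 * l0 + 11))%N%:R by rewrite ltr0n expn_gt0.
exists c; first by rewrite invr_gt0.
move=> k k3; set L := `|_|%N.
have Lk : (L * 2 ^ (2 * l0 + 11) <= k * k)%N.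
  have /natr_absz_floor_le le : 0 <= c * k%:R ^+ 2.
    by rewrite mulr_ge0 ?invr_ge0 ?ler0n // exprn_ge0.
  rewrite -(ler_nat R) natrM -ler_pdivlMr //; apply: le_trans le _.
  by rewrite natrM expr2 [leRHS]mulrC.
have /andP[kl kl'] := trunc_log_bounds (isT : 1 < 2)%N (ltnW (ltnW k3)).
set l := trunc_log 2 k in kl kl'.
have kk : (k * k < 2 ^ (2 * l + 2))%N.
  have -> : (2 * l + 2 = l.+1 + l.+1)%N by lia.
  by rewrite expnD ltn_mul.
rewrite ge_min; have [ll0|ll0] := ltnP l l0.
  suff -> : L = 0%N.
    by rewrite ler_nat vdW_le // => f; exists ord0, 0, 1; split=> // x [j].
  apply/eqP; rewrite -leqn0 leqNgt; apply/negP => L0.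
  have : (2 ^ (2 * l0 + 11) < 2 ^ (2 * l + 2))%N.
    by apply: leq_ltn_trans kk; apply: leq_trans Lk; rewrite leq_pmull.
  by rewrite ltn_exp2l //; lia.
have [|hil] := leP (2 `^ (k%:R `^ (5 / 2 - eps))) (hilbert k 4)%:R; first by rewrite orbT.
rewrite orbF ler_nat.
have D100 : (100 <= D)%N by rewrite leq_addr.
have lD : (D * (3 * D + 10) <= l)%N by apply: leq_trans ll0; rewrite leq_addr.
have el : 31 <= eps' * l%:R.
  rewrite mulrC -ler_pdivrMr // ltW // (lt_le_trans (archi_boundP _)) //.
    by rewrite divr_ge0 // ltW.
  by rewrite ler_nat (leq_trans _ ll0) // leq_addl.
clearbody D; have l1000 : (1000 <= l)%N.
  by apply: leq_trans lD; apply: (@leq_trans (100 * 10)) => //; rewrite leq_mul // leq_addl.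
have mu_le : (l %/ D * D <= l)%N by exact: leq_trunc_div.
have mu_le' : (100 * (l %/ D) <= l)%N.
  by apply: leq_trans mu_le; rewrite mulnC leq_mul2l D100 orbT.
have ga_le : (2 * ((l - 13) %/ 2) <= l - 13)%N by rewrite mulnC leq_trunc_div.
have ga_ge : (l - 14 <= 2 * ((l - 13) %/ 2))%N.
  by have := divn_eq (l - 13) 2; have := ltn_pmod (l - 13) (isT : 0 < 2)%N; lia.
have mu_exp : (3 * l + 5 <= 2 ^ (l %/ D))%N by rewrite linear_le_exp2 // (leq_trans _ D100).
move: mu_exp mu_le mu_le' ga_le ga_ge; move: (l %/ D)%N ((l - 13) %/ 2)%N.
move=> mu ga mu_exp mu_le mu_le' ga_le ga_ge.
apply: (@vdW_le_hilbert l mu ga (l - 3 - mu) k L) => //.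
- by move: mu_le' l1000; clear; lia.
- by rewrite kl kl'.
- rewrite -(leq_pmul2r (_ : 0 < 2 ^ 11)%N) ?expn_gt0 // -expnD.
  apply: (@leq_trans (k * k)).
    by apply: leq_trans Lk; rewrite leq_mul2l leq_exp2l // leq_addl orbT.
  by apply: ltnW; apply: leq_trans kk _; rewrite leq_exp2l //; move: l1000; clear; lia.
rewrite -(ler_nat R) natrX -powR_mulrn //; apply: le_trans (ltW hil) _.
apply: ler_powR; first by rewrite ler1n.
apply: (@le_trans _ _ (k%:R `^ (5 / 2 - eps'))).
  by apply: ler_powR; [rewrite ler1n (ltnW (ltnW k3))|rewrite lerD2l lerN2].
apply: (powR_le_pow2 (ga := ga) _ eD el mu_le kl') => //.
- by rewrite eps'0.
- by move: ga_ge mu_le' l1000; clear; lia.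
- by move: ga_ge l1000; clear; lia.
Qed.
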